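(* Let $\lambda>0$, $\pi\in\mathcal M$, and let $\delta_\lambda:\mathcal Z\times\mathcal G\times\bar{\mathcal G}\to\mathbb R$ satisfy the online variance inequality. For any sequence $Z_1,\dots,Z_n\in\mathcal Z$, the online SeqRand algorithm satisfies $$\mathbb E\sum_{i=1}^nL(Z_i,\hat g_{i-1})\le\min_{\rho\in\mathcal M}\Big\{\mathbb E_{g\sim\rho}\sum_{i=1}^nL(Z_i,g)+\mathbb E_{g\sim\rho}\,\mathbb E\sum_{i=1}^n\delta_\lambda(Z_i,g,\hat g_{i-1})+\frac{K(\rho,\pi)}\lambda\Big\},$$ where $\mathbb E$ (without subscript) is expectation with respect to the joint distribution of $\hat g_0,\dots,\hat g_{n-1}$. In particular, when $\mathcal G$ is finite, by taking $\pi$ uniform on $\mathcal G$, we get $$\mathbb E\sum_{i=1}^nL(Z_i,\hat g_{i-1})\le\min_{g\in\mathcal G}\Big\{\sum_{i=1}^nL(Z_i,g)+\mathbb E\sum_{i=1}^n\delta_\lambda(Z_i,g,\hat g_{i-1})+\frac{\log|\mathcal G|}\lambda\Big\}.$$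
   Context: Setting: $\mathcal Z=\mathcal X\times\mathcal Y$; a prediction function is a measurable map $\mathcal X\to\mathcal Y$; $\bar{\mathcal G}$ is the set of all prediction functions (equipped with a $\sigma$-algebra) and $\mathcal D$ the set of probability distributions on $\bar{\mathcal G}$; $\mathcal G\subset\bar{\mathcal G}$ is a measurable space and $\mathcal M$ the set of probability distributions on $\mathcal G$. $L(z,g)\in\mathbb R$ is the loss of $g$ on $z\in\mathcal Z$. No probabilistic assumption is made on the data $Z_1,\dots,Z_n$, which is an arbitrary sequence. All quantities are implicitly assumed measurable and the expectations well defined. $K(\rho,\pi)=\mathbb E_{g\sim\rho}\log\frac{d\rho}{d\pi}(g)$ if $\rho\ll\pi$, and $+\infty$ otherwise. For measurable $h:\mathcal G\to\mathbb R$, $\pi_{-h}(dg)=\frac{e^{-h(g)}}{\mathbb E_{g'\sim\pi}e^{-h(g')}}\pi(dg)$. Online variance inequality: for every $\rho\in\mathcal M$ there exists $\hat\pi(\rho)\in\mathcal D$ such that for every $Z\in\mathcal Z$, $$\mathbb E_{g'\sim\hat\pi(\rho)}\log\mathbb E_{g\sim\rho}e^{\lambda[L(Z,g')-L(Z,g)-\delta_\lambda(Z,g,g')]}\le0.$$ Online SeqRand algorithm: set $S_0\equiv0$, draw $\hat g_0$ from $\hat\rho_0=\hat\pi(\pi)$ and predict according to $\hat g_0$ for $Z_1$. For $i=1,\dots,n-1$, define $S_i(g)=S_{i-1}(g)+L(Z_i,g)+\delta_\lambda(Z_i,g,\hat g_{i-1})$ for $g\in\mathcal G$, let $\hat\rho_i=\hat\pi(\pi_{-\lambda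 S_i})$, draw $\hat g_i$ from $\hat\rho_i$ and predict according to $\hat g_i$ for $Z_{i+1}$. *)

(* Defs.v *)
From HB Require Import structures.
From mathcomp Require Import all_boot all_order all_algebra finmap.
From mathcomp Require Import all_classical all_reals all_analysis measurable_realfun.

Set Implicit Arguments.
Unset Strict Implicit.
Unset Printing Implicit Defensive.

Import Order.TTheory GRing.Theory Num.Theory.
Import numFieldNormedType.Exports.

Local Open Scope classical_set_scope.
Local Open Scope ring_scope.
Local Open Scope ereal_scope.
Local Open Scope charge_scope.

HB.instance Definition _ d d' (X : measurableType d) (Y : measurableType d') :=
  isPointed.Build {mfun X >-> Y} (cst point).

(* A nonempty subset G of T, seen as a type (the nonemptiness proof is only
   there because measurable types are pointed). *)
Definition subset_type (T : choiceType) (G : set T) (G0 : G !=set0) : Type :=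
  set_type G.

Section subset_type.
Context (T : choiceType) (G : set T) (G0 : G !=set0).

Lemma subset_type_inhabited : exists _ : subset_type G0, True.
Proof. by case: G0 => g Gg; exists (exist _ g (mem_set Gg)). Qed.

HB.instance Definition _ := Choice.copy (subset_type G0) (set_type G).
HB.instance Definition _ :=
  isPointed.Build (subset_type G0) (sval (cid subset_type_inhabited)).
End subset_type.

(* The set G may carry a sigma-algebra of its own, not necessarily the trace of
   one on T. *)
Definition model_incl (T : choiceType) (G : set T) (G0 : G !=set0)
  (S : set (set (subset_type G0))) (g : g_sigma_algebraType S) : T := sval g.

Section expectation_and_divergence.
Context d (T : measurableType d) (R : realType).

(* The expectation of f is well defined (possibly infinite): the positive and
   the negative part of f do not both have an infinite integral.  Otherwise
   \int[mu]_x f x is the meaningless +oo - +oo. *)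
Definition has_expectation (mu : probability T R) (f : T -> \bar R) : Prop :=
  \int[mu]_x f^\+ x +? - \int[mu]_x f^\- x.

Definition KL (rho pi : probability T R) : \bar R :=
  if `[< rho `<< pi >]
  then \int[rho]_g lne ('d (charge_of_finite_measure rho) '/d pi g)
  else +oo.

(* The probability measure with density e^{-h} / E_pi[e^{-h}] w.r.t. pi.  It
   exists as soon as h is measurable and E_pi[e^{-h}] is finite; the default
   value pi is used otherwise. *)
Definition gibbs (pi : probability T R) (h : T -> R) : probability T R :=
  xget pi [set rho : probability T R | forall A, measurable A ->
    rho A = \int[pi]_(g in A)
      (expR (- h g) / fine 'E_pi[fun g' => expR (- h g')])%:E].

Definition uniform_on_finite (pi : probability T R) : Prop :=
  forall A : set T, measurable A ->
    pi A = (#|` fset_set A|%:R / #|` fset_set [set: T]|%:R)%:E.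

End expectation_and_divergence.

Section seqrand.
Context (R : realType) (Z : Type) dG (G : measurableType dG)
  dB (Gbar : measurableType dB) (incl : G -> Gbar).
Variables (lambda : R) (L : Z -> Gbar -> R) (delta : Z -> G -> Gbar -> R).

(* [online_variance_bound rho pihat]: the distribution pihat on Gbar can be
   chosen as pihat(rho) in the online variance inequality. *)
Definition online_variance_bound (rho : probability G R)
    (pihat : probability Gbar R) : Prop :=
  forall z : Z,
    let f g' := lne 'E_rho[fun g =>
      expR (lambda * (L z g' - L z (incl g) - delta z g g'))] in
    has_expectation pihat f /\ \int[pihat]_g' f g' <= 0.

Variables (pi : probability G R) (pihat : probability G R -> probability Gbar R).
(* The data are numbered from 0: z i is Z_{i+1}. *)
Variable z : nat -> Z.

(* S_i, as a function of the predictors drawn at steps 0, ..., i - 1. *)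
Definition cumulative_loss i (hist : i.-tuple Gbar) (g : G) : R :=
  (\sum_(j < i) (L (z j) (incl g) + delta (z j) g (tnth hist j)))%R.

(* The distribution rhohat_i from which the i-th predictor is drawn, as a
   function of the predictors drawn before. *)
Definition predictor_law i (hist : i.-tuple Gbar) : probability Gbar R :=
  if i == 0%N then pihat pi
  else pihat (gibbs pi (fun g => lambda * cumulative_loss hist g)%R).

Section run.
Context dO (Omega : measurableType dO) (P : probability Omega R).
Variable ghat : nat -> {RV P >-> Gbar}.

Definition history i (w : Omega) : i.-tuple Gbar := [tuple ghat j w | j < i].

(* ghat 0, ..., ghat n.-1 are the random predictors of a run of the algorithm:
   for i < n, rhohat_i is a probability kernel and is the conditional
   distribution of ghat i given ghat 0, ..., ghat i.-1. *)
Definition seqrand_run (n : nat) : Prop :=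
  forall i, (i < n)%N ->
    (forall B : set Gbar, measurable B ->
      measurable_fun [set: i.-tuple Gbar]
        (fun hist => predictor_law hist B)) /\
    (forall (A : set (i.-tuple Gbar)) (B : set Gbar),
      measurable A -> measurable B ->
      P ((history i @^-1` A) `&` (ghat i @^-1` B)) =
        \int[P]_(w in history i @^-1` A) predictor_law (history i w) B).

Definition total_loss (n : nat) (w : Omega) : R :=
  (\sum_(i < n) L (z i) (ghat i w))%R.

Definition fixed_loss (n : nat) (g : G) : R :=
  (\sum_(i < n) L (z i) (incl g))%R.

Definition total_delta (n : nat) (g : G) (w : Omega) : R :=
  (\sum_(i < n) delta (z i) g (ghat i w))%R.

Definition loss_bound (n : nat) (rho : probability G R) : \bar R :=
  'E_rho[fixed_loss n] + \int[rho]_g 'E_P[total_delta n g]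
  + lambda^-1%:E * KL rho pi.

(* Every expectation and every sum in loss_bound n rho is well defined. *)
Definition loss_bound_defined (n : nat) (rho : probability G R) : Prop :=
  [/\ has_expectation rho (EFin \o fixed_loss n),
      {ae rho, forall g, has_expectation P (EFin \o total_delta n g)},
      has_expectation rho (fun g => 'E_P[total_delta n g]),
      'E_rho[fixed_loss n] +? \int[rho]_g 'E_P[total_delta n g] &
      'E_rho[fixed_loss n] + \int[rho]_g 'E_P[total_delta n g]
        +? lambda^-1%:E * KL rho pi].

End run.
End seqrand.

(* Main.v *)
Require Import Defs.
From HB Require Import structures.
From mathcomp Require Import all_boot all_order all_algebra finmap.
From mathcomp Require Import all_classical all_reals all_analysis measurable_realfun.

(** Let [W_i] be the expectation under [pi] of [exp (- lambda * S_i)] and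
    [M_i = sum_(j < i) L (Z_(j+1), ghat_j) + lambda^-1 * ln W_i], so [M_0 = 0].
    As [exp (- lambda * S_i) / W_i] is the density of the Gibbs law, the online
    variance inequality says exactly that, given the history, the increment
    [M_(i+1) - M_i] has mean at most 0.  These increments need not be
    integrable: only their positive parts are, conditionally on the history.
    Nevertheless, going backwards in time, [E (M_n)^- < +oo] implies
    [E M_n <= 0].

    To compare [M_n] with the right-hand side for a given [rho], put
    [V g w = sum_i L (Z_i, ghat_(i-1)) - S_n g - lambda^-1 * ln (drho/dpi g)].
    The convexity inequality
    [V <= M_n - lambda^-1 + lambda^-1 * exp (lambda * (V - M_n))]
    plays the role of Jensen's inequality (Donsker-Varadhan); the last term has
    a double integral at most [lambda^-1], in whichever order.  Integrating over
    [w] for one fixed [g] yields [E (M_n)^- < +oo]; integrating over [w] and then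
    over [g] yields the bound.  No joint integrability of [delta] in [(g, w)] is
    required. *)

Set Implicit Arguments.
Unset Strict Implicit.
Unset Printing Implicit Defensive.

From mathcomp Require Import ring lra.
Import Order.TTheory GRing.Theory Num.Theory.
Import numFieldNormedType.Exports.

Local Open Scope classical_set_scope.
Local Open Scope ring_scope.
Local Open Scope ereal_scope.

(** * Disintegration of a joint law along a probability kernel *)

Section graph_kernel.
Context dO dH dB (Omega : measurableType dO) (H : measurableType dH)
  (B : measurableType dB) (R : realType).
Variables (h : Omega -> H) (k : H -> probability B R).
Hypothesis mh : measurable_fun [set: Omega] h.
Hypothesis mk : forall A, measurable A -> measurable_fun [set: H] (k ^~ A).

(** The law of [(h w, b)] with [b] drawn from [k (h w)]. The factor [unit] lets it be composed by
    [\;] with [P], seen below as the kernel [kP] from [unit]. *)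
Definition graph_kernel (x : unit * Omega) : set (H * B) -> \bar R :=
  pushforward (k (h x.2)) (pair (h x.2)).

Let measurable_pair_h x : measurable_fun [set: B] (pair (h x) : B -> H * B).
Proof. exact: measurable_pair1. Qed.

Let graph_kernel0 x : graph_kernel x set0 = 0.
Proof. by rewrite /graph_kernel /pushforward preimage_set0 measure0. Qed.

Let graph_kernel_ge0 x A : 0 <= graph_kernel x A.
Proof. exact: measure_ge0. Qed.

Let graph_kernel_sigma_additive x : semi_sigma_additive (graph_kernel x).
Proof.
exact: (@measure_semi_sigma_additive _ _ _ (pushforward (k (h x.2)) (pair (h x.2)))).
Qed.

HB.instance Definition _ x := isMeasure.Build _ _ _ (graph_kernel x)
  (graph_kernel0 x) (graph_kernel_ge0 x) (@graph_kernel_sigma_additive x).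

Let kh (x : H) : {measure set B -> \bar R} := k x.
HB.instance Definition _ := isKernel.Build _ _ _ _ _ kh mk.
Let kh1 x : kh x [set: B] = 1. Proof. exact: probability_setT. Qed.
HB.instance Definition _ := Kernel_isProbability.Build _ _ _ _ _ kh kh1.

Lemma measurable_fun_integral_probability (f : H * B -> \bar R) :
  (forall x, 0 <= f x) -> measurable_fun setT f ->
  measurable_fun setT (fun w => \int[k (h w)]_b f (h w, b)).
Proof.
move=> f0 mf.
exact: (measurableT_comp (measurable_fun_integral_finite_kernel f kh f0 mf) mh).
Qed.

Let gk (x : unit * Omega) : {measure set (H * B) -> \bar R} := graph_kernel x.

Let measurable_gk A : measurable A -> measurable_fun setT (gk ^~ A).
Proof.
move=> mA; rewrite (_ : gk ^~ A = (fun x => kh x (xsection A x)) \o h \o snd);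
  last first.
  by apply/funext => x /=; rewrite /gk /= /graph_kernel /pushforward /= xsectionE.
apply: measurableT_comp => //; apply: measurableT_comp => //.
by apply: measurable_fun_xsection_finite_kernel; rewrite inE.
Qed.
HB.instance Definition _ := isKernel.Build _ _ _ _ _ gk measurable_gk.
Let gk1 x : gk x setT = 1. Proof. exact: probability_setT. Qed.
HB.instance Definition _ := Kernel_isProbability.Build _ _ _ _ _ gk gk1.

Variables (P : probability Omega R) (y : Omega -> B).
Hypothesis my : measurable_fun [set: Omega] y.
Hypothesis rect : forall A C, measurable A -> measurable C ->
  P ((h @^-1` A) `&` (y @^-1` C)) = \int[P]_(w in h @^-1` A) k (h w) C.

Let kP (x : unit) : {measure set Omega -> \bar R} := P.
Let measurable_kP A : measurable A -> measurable_fun setT (kP ^~ A).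
Proof. by []. Qed.
HB.instance Definition _ := isKernel.Build _ _ _ _ _ kP measurable_kP.
Let kP1 x : kP x setT = 1. Proof. exact: probability_setT. Qed.
HB.instance Definition _ := Kernel_isProbability.Build _ _ _ _ _ kP kP1.

Let hy w := (h w, y w).
Let mhy : measurable_fun setT hy. Proof. exact: measurable_fun_pair. Qed.

(** Both sides are finite measures. By [rect] they agree on the measurable rectangles, which are
    stable under intersection and generate the product sigma-algebra. *)
Let joint_law A : measurable A -> pushforward P hy A = (kP \; gk) tt A.
Proof.
move=> mA; pose C : set (set (H * B)) :=
  [set A `*` B | A in measurable & B in measurable].
have Ce : measurable = <<s C >> by exact: measurable_prod_measurableType.
apply: (@measure_unique _ _ _ C (fun=> setT) Ce _ _ _ (pushforward P hy)
  ((kP \; gk) tt)) => //.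
- move=> _ _ [X1 mX1 [X2 mX2 <-]] [Y1 mY1 [Y2 mY2 <-]].
  rewrite -setXI; exists (X1 `&` Y1); first exact: measurableI.
  by exists (X2 `&` Y2) => //; exact: measurableI.
- by move=> _; exists setT => //; exists setT => //; rewrite setXTT.
- by rewrite bigcup_const.
- move=> _ [X mX [Y mY <-]].
  transitivity (P ((h @^-1` X) `&` (y @^-1` Y))) => //.
  rewrite rect// /= /kcomp [LHS]integral_mkcond/=.
  apply: eq_integral => w _; rewrite patchE /gk /= /graph_kernel /pushforward /=.
  case: ifPn => [/set_mem /= hX|/negP hX].
    by congr (k _ _); apply/seteqP; split => b //= [].
  by rewrite [X in k _ X](_ : _ = set0) ?measure0//; apply/seteqP;
    split => b //= -[/mem_set].
- by move=> _; rewrite /= /pushforward /= preimage_setT probability_setT ltry.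
Qed.

Lemma disintegration (f : H * B -> \bar R) : (forall x, 0 <= f x) ->
  measurable_fun setT f ->
  \int[P]_w f (h w, y w) = \int[P]_w \int[k (h w)]_b f (h w, b).
Proof.
move=> f0 mf.
have /= := ge0_integral_pushforward mhy P measurableT mf (fun x _ => f0 x).
rewrite preimage_setT => <-.
rewrite (eq_measure_integral ((kP \; gk) tt)); last first.
  by move=> A mA _; exact: joint_law.
rewrite integral_kcomp//.
apply: eq_integral => w _.
have := ge0_integral_pushforward (measurable_pair_h w) (k (h w)) measurableT mf
  (fun x _ => f0 x).
by rewrite preimage_setT.
Qed.

End graph_kernel.

(** * Integrability criteria and well-defined expectations *)

Section integral_extra.
Context d (T : measurableType d) (R : realType).
Variable mu : {measure set T -> \bar R}.

Lemma integrable_funeposneg (f : T -> \bar R) : measurable_fun setT f ->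
  \int[mu]_x f^\+ x < +oo -> \int[mu]_x f^\- x < +oo -> mu.-integrable setT f.
Proof.
move=> mf fp fn; rewrite [X in integrable _ _ X]funeposneg.
apply: integrableB => //; apply/integrableP; split.
- exact: measurable_funepos.
- by under eq_integral do rewrite gee0_abs//.
- exact: measurable_funeneg.
- by under eq_integral do rewrite gee0_abs//.
Qed.

(** [|f|] is almost everywhere at most [|a| + |b|]. This turns one-sided bounds into integrability
    in the comparison below. *)
Lemma integrable_sandwich (a b f : T -> R) :
  mu.-integrable setT (EFin \o a) -> mu.-integrable setT (EFin \o b) ->
  measurable_fun setT f -> {ae mu, forall x, (a x <= f x <= b x)%R} ->
  mu.-integrable setT (EFin \o f).
Proof.
move=> ia ib mf afb; have ma := measurable_int _ ia; have mb := measurable_int _ ib.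
have mf' : measurable_fun setT (EFin \o f) by exact/measurable_EFinP.
apply/integrableP; split => //.
apply: (@le_lt_trans _ _ (\int[mu]_x (`|(a x)%:E| + `|(b x)%:E|))).
  apply: ae_ge0_le_integral => //.
  - exact: measurableT_comp.
  - by move=> x _; rewrite adde_ge0.
  - by apply: emeasurable_funD; exact: measurableT_comp.
  move: afb; apply: filterS => x /andP[ax bx] _ /=.
  rewrite -EFinD lee_fin ler_norml; apply/andP; split.
    rewrite (le_trans _ ax)// lerNl (le_trans (ler_norm _))// normrN.
    by rewrite lerDl.
  by rewrite (le_trans bx)// (le_trans (ler_norm _))// lerDr.
rewrite ge0_integralD//; [|exact: measurableT_comp..].
by rewrite lte_add_pinfty//; [case/integrableP: ia|case/integrableP: ib].
Qed.

(** The difference [g - f] is almost everywhere equal to its positive part, whose integral is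
    nonnegative. *)
Lemma ae_le_integral (f g : T -> R) :
  mu.-integrable setT (EFin \o f) -> mu.-integrable setT (EFin \o g) ->
  {ae mu, forall x, (f x <= g x)%R} ->
  \int[mu]_x (f x)%:E <= \int[mu]_x (g x)%:E.
Proof.
move=> if_ ig fg; rewrite -sube_ge0; last first.
  by rewrite (integrable_fin_num measurableT if_)// orbT.
have igf := integrableB measurableT ig if_.
rewrite -(integralB measurableT ig if_).
rewrite (@ae_eq_integral _ _ _ mu setT ((EFin \o g) \- (EFin \o f))^\+)//.
- exact: integral_ge0.
- exact: (measurable_int _ igf).
- by apply: measurable_funepos; exact: (measurable_int _ igf).
- move: fg; apply: filterS => x fgx _ /=.
  by rewrite funeposE max_l// -EFinB lee_fin subr_ge0.
Qed.

End integral_extra.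

Section has_expectation_extra.
Context d (T : measurableType d) (R : realType) (mu : probability T R).

(** As [+oo - +oo] evaluates to [-oo], an integral below [+oo] controls the positive part only when
    the expectation is well defined. *)
Lemma has_expectation_funepos_lty (f : T -> \bar R) : has_expectation mu f ->
  \int[mu]_x f x < +oo -> \int[mu]_x f^\+ x < +oo.
Proof.
rewrite /has_expectation [\int[mu]_x f x]integralE !ltey => def.
apply: contra_neq => fy; rewrite fy in def *.
by case: (\int[mu]_x f^\- x) def.
Qed.

Lemma has_expectation_funeneg_lty (f : T -> \bar R) : has_expectation mu f ->
  -oo < \int[mu]_x f x -> \int[mu]_x f^\- x < +oo.
Proof.
rewrite /has_expectation [\int[mu]_x f x]integralE ltNye ltey => def.
apply: contra_neq => fy; rewrite fy in def *.
by case: (\int[mu]_x f^\+ x) def.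
Qed.

Lemma integral_cst_probability (r : R) : \int[mu]_x r%:E = r%:E.
Proof.
rewrite integral_cst// -[RHS]mule1; congr (_ * _); exact: probability_setT.
Qed.

Lemma measurable_fun_integral d' (S : measurableType d') (f : S * T -> \bar R) :
  measurable_fun setT f -> measurable_fun setT (fun x => \int[mu]_y f (x, y)).
Proof.
move=> mf.
rewrite (_ : (fun x => _) = fubini_F mu f^\+ \- fubini_F mu f^\-); last first.
  apply/funext => x; rewrite [LHS]integralE /fubini_F /=; congr (_ - _);
    by apply: eq_integral => y _; rewrite ?funeposE ?funenegE.
apply: emeasurable_funB.
  by apply: measurable_fun_fubini_tonelli_F => //; exact: measurable_funepos.
by apply: measurable_fun_fubini_tonelli_F => //; exact: measurable_funeneg.
Qed.

(** The whole space has mass 1, so it is not negligible. This serves to pick one predictor [g] that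
    is good for [rho]. *)
Lemma ae_exists (A : T -> Prop) : {ae mu, forall x, A x} -> exists x, A x.
Proof.
move=> [N [mN N0 AN]]; apply: contrapT => nA.
have NT : N = setT.
  by apply/seteqP; split => // x _; apply: AN => /= Ax; apply: nA; exists x.
by move: N0; rewrite NT probability_setT => /eqP; rewrite onee_eq0.
Qed.

End has_expectation_extra.

(** * Measures with a density *)

Section density.
Context d (T : measurableType d) (R : realType) (mu : probability T R).

Lemma integral_expR_gt0 (f : T -> R) : measurable_fun setT f ->
  0 < \int[mu]_x (expR (f x))%:E.
Proof.
move=> mf; rewrite lt0e integral_ge0 ?andbT; last first.
  by move=> x _; rewrite lee_fin expR_ge0.
have mef : measurable_fun setT (fun x => (expR (f x))%:E).
  by apply/measurable_EFinP; exact: measurableT_comp.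
apply/eqP => f0.
have /(ae_eq_integral_abs mu measurableT mef) : \int[mu]_x `|(expR (f x))%:E| = 0.
  by under eq_integral do rewrite gee0_abs ?lee_fin ?expR_ge0//.
move=> /ae_exists[x /(_ Logic.I)] /= /eqP; rewrite eqe.
by rewrite gt_eqF// expR_gt0.
Qed.

Variables (r : T -> R).
Hypotheses (mr : measurable_fun setT r) (r_ge0 : forall x, (0 <= r x)%R).

(** [nu] is dominated by [mu], and [r] agrees almost everywhere with the Radon-Nikodym derivative
    because both have the same integral over every measurable set. *)
Lemma ge0_integral_density (nu : probability T R) (f : T -> \bar R) :
  (forall A, measurable A -> nu A = \int[mu]_(x in A) (r x)%:E) ->
  (forall x, 0 <= f x) -> measurable_fun setT f ->
  \int[nu]_x f x = \int[mu]_x (f x * (r x)%:E).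
Proof.
move=> nuE f0 mf.
have mrE : measurable_fun setT (EFin \o r) by exact/measurable_EFinP.
have numu : nu `<< mu.
  apply/null_content_dominatesP => A mA muA; rewrite nuE//.
  by apply: null_set_integral => //; exact: measurable_funTS.
rewrite -(Radon_Nikodym_SigmaFinite.change_of_variables numu)//.
have irn := Radon_Nikodym_SigmaFinite.f_integrable numu.
have mrn := measurable_int _ irn.
apply: ae_eq_integral => //.
- exact: emeasurable_funM.
- exact: emeasurable_funM.
apply: ae_eqe_mul2l; apply: integral_ae_eq => // A _ mA.
by rewrite -nuE//; exact/esym/Radon_Nikodym_SigmaFinite.f_integral.
Qed.

Hypothesis r1 : \int[mu]_x (r x)%:E = 1.

Definition density_measure (A : set T) : \bar R := \int[mu]_(x in A) (r x)%:E.

Let density0 : density_measure set0 = 0.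
Proof. by rewrite /density_measure integral_set0. Qed.

Let density_ge0 A : 0 <= density_measure A.
Proof. by apply: integral_ge0 => x _; rewrite lee_fin. Qed.

Let density_sigma_additive : semi_sigma_additive density_measure.
Proof.
apply: semi_sigma_additive_nng_induced; first exact/measurable_EFinP.
by move=> x; rewrite lee_fin.
Qed.

HB.instance Definition _ := isMeasure.Build _ _ _ density_measure
  density0 density_ge0 density_sigma_additive.
HB.instance Definition _ := Measure_isProbability.Build _ _ _ density_measure r1.

Lemma density_probability : exists nu : probability T R,
  forall A, measurable A -> nu A = \int[mu]_(x in A) (r x)%:E.
Proof. by exists density_measure. Qed.

End density.

(** [gibbs] is chosen by [xget], so its density is known only once some measure with that density
    has been exhibited. A finite partition function makes the density integrate to 1. *)
Lemma gibbsE d (T : measurableType d) (R : realType) (pi : probability T R)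
    (h : T -> R) (f : T -> \bar R) :
  measurable_fun setT h -> \int[pi]_x (expR (- h x))%:E < +oo ->
  (forall x, 0 <= f x) -> measurable_fun setT f ->
  \int[gibbs pi h]_x f x =
  \int[pi]_x (f x * (expR (- h x) / fine (\int[pi]_x (expR (- h x))%:E))%:E).
Proof.
move=> mh fin; set W := \int[pi]_x _ in fin *.
have mNh : measurable_fun setT (\- h)%R by exact: measurableT_comp.
have W0 : 0 < W by exact: (integral_expR_gt0 pi mNh).
have Wfin : W \is a fin_num by rewrite ge0_fin_numE// ltW.
have W0' : (0 < fine W)%R by rewrite fine_gt0// W0.
have mr : measurable_fun setT (fun x => expR (- h x) / fine W)%R.
  by apply: measurable_funM => //; exact: measurableT_comp.
apply: (ge0_integral_density mr) => //.
have [nu nuE] : exists nu : probability T R, forall A, measurable A ->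
    nu A = \int[pi]_(x in A) (expR (- h x) / fine W)%:E.
  apply: (density_probability mr).
    by move=> x; rewrite divr_ge0 ?expR_ge0// ltW.
  under eq_integral do rewrite mulrC EFinM.
  rewrite ge0_integralZl//.
  - by rewrite -/W -(fineK Wfin) -EFinM mulVf// gt_eqF.
  - by apply/measurable_EFinP; exact: measurableT_comp.
  - by rewrite lee_fin invr_ge0 ltW.
have := @xgetPex _ pi [set rho : probability T R | forall A, measurable A ->
    rho A = \int[pi]_(g in A)
      (expR (- h g) / fine 'E_pi[fun g' => expR (- h g')])%:E].
rewrite -/(gibbs pi h) unlock; apply.
by exists nu => A mA; rewrite nuE// unlock.
Qed.

(* The value [+oo] of [w] is that of a partition function, for which [m1]
   (computed with [fine]) is a junk value. *)
Lemma supermartingale_step d (T : measurableType d) (R : realType)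
    (kap : probability T R) (lambda m0 : R) (m1 : T -> R) (w : T -> \bar R)
    (F := fun b => if w b == +oo then +oo else (lambda * (m1 b - m0))%:E) :
  (0 < lambda)%R -> measurable_fun setT m1 -> measurable_fun setT w ->
  has_expectation kap F -> \int[kap]_b F b <= 0 ->
  [/\ {ae kap, forall b, w b != +oo},
      (Num.max (- m0) 0)%:E <= \int[kap]_b ((m1^\-)%R b)%:E &
      (Num.max (- m0) 0)%:E + \int[kap]_b ((m1^\+)%R b)%:E <=
      (Num.max m0 0)%:E + \int[kap]_b ((m1^\-)%R b)%:E].
Proof.
move=> lambda0 mm1 mw hF F0.
have mF : measurable_fun setT F.
  apply: measurable_fun_ifT => //.
    apply: (measurable_fun_bool true).
    rewrite [X in measurable X](_ : _ = setT `&` w @^-1` [set +oo]).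
      exact: mw (emeasurable_set1 _).
    by congr (_ `&` _); apply/seteqP; split => b /= /eqP.
  by apply/measurable_EFinP/measurable_funM => //; exact: measurable_funB.
have Fp : \int[kap]_b F^\+ b < +oo.
  by apply: has_expectation_funepos_lty => //; exact: le_lt_trans F0 _.
have FpFn : \int[kap]_b F^\+ b <= \int[kap]_b F^\- b.
  by move: F0; rewrite integralE sube_le0.
(* [F] is [+oo] wherever [w] is, and [F^\+] is integrable. *)
have good : {ae kap, forall b, w b != +oo}.
  have iFp : kap.-integrable setT F^\+.
    apply/integrableP; split; first exact: measurable_funepos.
    by under eq_integral do rewrite gee0_abs//.
  move: (integrable_ae measurableT iFp); apply: filterS => b /(_ Logic.I).
  by rewrite funeposE /F; case: eqP => //; rewrite max_l ?leey.
set n0 := Num.max (- m0)%R 0%R; set p0 := Num.max m0 0%R.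
have n0_ge0 : (0 <= n0)%R by rewrite le_max lexx orbT.
have p0_ge0 : (0 <= p0)%R by rewrite le_max lexx orbT.
have np0 : (p0 - n0 = m0)%R.
  by rewrite /p0 /n0; case: (leP m0 0%R); case: (leP (- m0)%R 0%R); lra.
set a1 := \int[kap]_b ((m1^\+)%R b)%:E; set b1 := \int[kap]_b ((m1^\-)%R b)%:E.
have a1_ge0 : 0 <= a1 by apply: integral_ge0 => b _; rewrite lee_fin.
have b1_ge0 : 0 <= b1 by apply: integral_ge0 => b _; rewrite lee_fin.
have Fn_ge0 : 0 <= \int[kap]_b F^\- b by exact: integral_ge0.
have Fp_ge0 : 0 <= \int[kap]_b F^\+ b by exact: integral_ge0.
have mm1p : measurable_fun setT (fun b => ((m1^\+)%R b)%:E).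
  exact/measurable_EFinP/measurable_funrpos.
have mm1n : measurable_fun setT (fun b => ((m1^\-)%R b)%:E).
  exact/measurable_EFinP/measurable_funrneg.
have lambdaE (f : T -> R) (r : R) (g : T -> \bar R) : (0 <= r)%R ->
    (forall b, 0 <= f b)%R -> measurable_fun setT (EFin \o f) ->
    (forall b, 0 <= g b) -> measurable_fun setT g ->
    \int[kap]_b (lambda%:E * (f b)%:E + (g b + (lambda * r)%:E)) =
    lambda%:E * \int[kap]_b (f b)%:E + (\int[kap]_b g b + (lambda * r)%:E).
  move=> r0 f0 mf g0 mg.
  have lr0 : (0 <= lambda * r)%R by rewrite mulr_ge0// ltW.
  rewrite ge0_integralD//; last 4 first.
  - by move=> b _; rewrite mule_ge0 ?lee_fin// ltW.
  - exact: measurable_funeM.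
  - by move=> b _; rewrite adde_ge0 ?lee_fin.
  - exact: emeasurable_funD.
  rewrite ge0_integralD//.
  rewrite ge0_integralZl// ?lee_fin ?ltW//; last by move=> b _; rewrite lee_fin.
  by rewrite integral_cst_probability.
(* The identity [F = lambda * (m1 - m0)] is split into positive and negative parts and rearranged
   into sums of nonnegative terms, so that it can be integrated before anything is known to be
   integrable. *)
have eqi : lambda%:E * a1 + (\int[kap]_b F^\- b + (lambda * n0)%:E) =
    lambda%:E * b1 + (\int[kap]_b F^\+ b + (lambda * p0)%:E).
  rewrite -(lambdaE (m1^\+)%R n0 F^\-)//; last exact: measurable_funeneg.
  rewrite -(lambdaE (m1^\-)%R p0 F^\+)//; last exact: measurable_funepos.
  apply: ae_eq_integral => //.
  - apply: emeasurable_funD; first exact: measurable_funeM.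
    by apply: emeasurable_funD => //; exact: measurable_funeneg.
  - apply: emeasurable_funD; first exact: measurable_funeM.
    by apply: emeasurable_funD => //; exact: measurable_funepos.
  move: good; apply: filterS => b wb _.
  rewrite funenegE funeposE /F (negbTE wb) -EFinN -!EFin_max -!EFinM -!EFinD.
  congr EFin; rewrite /funrpos /funrneg.
  have -> : (Num.max (- (lambda * (m1 b - m0))) 0 =
      Num.max (lambda * (m1 b - m0)) 0 - lambda * (m1 b - m0))%R.
    set t := (lambda * _)%R.
    by case: (leP t 0%R); case: (leP (- t)%R 0%R); lra.
  have -> : (Num.max (- m1 b) 0 = Num.max (m1 b) 0 - m1 b)%R.
    by case: (leP (m1 b) 0%R); case: (leP (- m1 b)%R 0%R); lra.
  by rewrite -np0; ring.
clearbody a1 b1.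
(* If [b1] is infinite, both inequalities are trivial. Otherwise the right-hand side of [eqi] is
   finite, hence so is every term on the left, and real arithmetic applies. *)
have [b1y|b1y] := eqVneq b1 +oo.
  by split => //; rewrite b1y ?leey// addey// leey.
have fb1 : b1 \is a fin_num by rewrite ge0_fin_numE// ltey.
have fFp : \int[kap]_b F^\+ b \is a fin_num by rewrite ge0_fin_numE.
have fsum : lambda%:E * a1 + (\int[kap]_b F^\- b + (lambda * n0)%:E) \is a fin_num.
  by rewrite eqi -(fineK fb1) -(fineK fFp) -!EFinM.
have [fa1 fFn] : a1 \is a fin_num /\ \int[kap]_b F^\- b \is a fin_num.
  move: fsum; rewrite !fin_numD => /and3P[la1 fFn _]; split => //.
  rewrite ge0_fin_numE// ltey; apply/eqP => a1y.
  by move: la1; rewrite a1y gt0_muley ?lte_fin.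
move: eqi FpFn a1_ge0; rewrite -(fineK fa1) -(fineK fb1) -(fineK fFp) -(fineK fFn).
rewrite -!EFinM -!EFinD !lee_fin => -[eqi] FpFn a1_ge0.
have le : (n0 + fine a1 <= p0 + fine b1)%R.
  rewrite -(ler_pM2l lambda0) !mulrDr; lra.
(* One of [n0] and [p0] vanishes: if [n0 = 0] the first bound is clear, and if [p0 = 0] it follows
   from [le] and [0 <= a1]. *)
split => //; move: le; rewrite /n0 /p0.
have b1_ge0' := fine_ge0 b1_ge0.
by case: (leP m0 0%R); case: (leP (- m0)%R 0%R); lra.
Qed.

(** * Comparing a supermartingale with its exponential majorant *)

Section comparison.
Context dO dG (Omega : measurableType dO) (G : measurableType dG) (R : realType).
Variables (P : probability Omega R) (rho : probability G R).
Variables (lambda : R) (M A : Omega -> R) (s k : G -> R) (D : G -> Omega -> R).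
Hypothesis lambda_gt0 : (0 < lambda)%R.
Hypotheses (mM : measurable_fun setT M) (mA : measurable_fun setT A).
Hypotheses (ms : measurable_fun setT s).
Hypothesis mD : measurable_fun setT (fun x : G * Omega => D x.1 x.2).

Let c : R := lambda^-1.
(** In the application [A] is the total loss of the run, [s] and [D] are the loss and the total
    [delta] of a fixed predictor, [M] is the final free energy, and [k] is [lambda^-1] times the
    log-density of [rho] with respect to [pi], or an upper bound of it. *)
Let V g w : R := (A w - s g - D g w - k g)%R.
Let E g w : R := (c * expR (lambda * (V g w - M w)))%R.
Let e g : \bar R := \int[P]_w (D g w)%:E.

Hypothesis M_mean_le0 : \int[P]_w ((M^\-)%R w)%:E < +oo ->
  \int[P]_w ((M^\+)%R w)%:E <= \int[P]_w ((M^\-)%R w)%:E.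
Hypothesis expV_le1 :
  {ae P, forall w, \int[rho]_g (expR (lambda * (V g w - M w)))%:E <= 1}.
Hypothesis ik : rho.-integrable setT (EFin \o k).
Hypothesis hA : has_expectation P (EFin \o A).
Hypothesis hs : has_expectation rho (EFin \o s).
Hypothesis hD : {ae rho, forall g, has_expectation P (EFin \o D g)}.
Hypothesis he : has_expectation rho e.
Hypothesis hse : \int[rho]_g (s g)%:E +? \int[rho]_g e g.

Let mk : measurable_fun setT k.
Proof. exact/measurable_EFinP/(measurable_int _ ik). Qed.

Let mE : measurable_fun setT (fun x : G * Omega => E x.1 x.2).
Proof.
apply: measurable_funM => //; apply: measurableT_comp => //.
apply: measurable_funM => //; apply: measurable_funB; last exact: measurableT_comp.
by repeat apply: measurable_funB => //; exact: measurableT_comp.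
Qed.

Let mD1 g : measurable_fun setT (D g).
Proof. exact: (measurableT_comp mD (measurable_pair1 g)). Qed.

Let mE1 g : measurable_fun setT (E g).
Proof. exact: (measurableT_comp mE (measurable_pair1 g)). Qed.

Let E_ge0 g w : (0 <= E g w)%R.
Proof. by rewrite mulr_ge0 ?expR_ge0// invr_ge0 ltW. Qed.

(* [1 + x <= exp x] at [x = lambda * (V g w - M w)]. *)
Let V_le g w : (V g w <= M w - c + E g w)%R.
Proof.
have := expR_ge1Dx (lambda * (V g w - M w)).
rewrite -(ler_pM2l (_ : 0 < c)%R) ?invr_gt0// -/(E g w) mulrDr mulr1 mulrA.
by rewrite mulVf ?gt_eqF// mul1r; lra.
Qed.

Let q g : \bar R := \int[P]_w (E g w)%:E.

Let mq : measurable_fun setT q.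
Proof.
apply: (@measurable_fun_fubini_tonelli_F _ _ _ _ _ P
  (fun x : G * Omega => (E x.1 x.2)%:E)).
  exact/measurable_EFinP.
by move=> x; rewrite lee_fin.
Qed.

Let q_ge0 g : 0 <= q g.
Proof. by apply: integral_ge0 => w _; rewrite lee_fin. Qed.

(** Tonelli puts the integral over [g] inside, where [expV_le1] applies for almost every [w]. The
    bound [c] will cancel the [- c] of [V_le]. *)
Let int_q : \int[rho]_g q g <= c%:E.
Proof.
have -> : \int[rho]_g q g = \int[P]_w \int[rho]_g (E g w)%:E.
  apply: (@fubini_tonelli _ _ _ _ _ rho P (fun x : G * Omega => (E x.1 x.2)%:E)).
    exact/measurable_EFinP.
  by move=> x; rewrite lee_fin.
rewrite -(integral_cst_probability P c).
have mE2 w : measurable_fun setT (E^~ w).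
  exact: (measurableT_comp mE (measurable_pair2 w)).
apply: ae_ge0_le_integral => //.
- by move=> w _; apply: integral_ge0 => g _; rewrite lee_fin.
- apply: (@measurable_fun_fubini_tonelli_G _ _ _ _ _ rho
    (fun x : G * Omega => (E x.1 x.2)%:E)).
    exact/measurable_EFinP.
  by move=> x; rewrite lee_fin.
- by move=> w _; rewrite lee_fin invr_ge0 ltW.
move: expV_le1; apply: filterS => w le1 _.
under eq_integral do rewrite EFinM.
rewrite ge0_integralZl//; last 2 first.
- apply/measurable_EFinP.
  have := measurable_funM (measurable_cst lambda) (mE2 w).
  rewrite (_ : (_ \* _)%R = fun g => expR (lambda * (V g w - M w)))//.
  apply/funext => g /=; rewrite /E mulrA divff ?mul1r// gt_eqF//.
- by rewrite lee_fin invr_ge0 ltW.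
by rewrite -[leRHS]mule1; apply: lee_wpmul2l => //; rewrite lee_fin invr_ge0 ltW.
Qed.

Let iq : rho.-integrable setT q.
Proof.
apply/integrableP; split => //; under eq_integral do rewrite gee0_abs//.
exact: le_lt_trans int_q (ltry _).
Qed.

Let me : measurable_fun setT e.
Proof.
apply: (measurable_fun_integral P (f := fun x : G * Omega => (D x.1 x.2)%:E)).
exact/measurable_EFinP.
Qed.

(** At first only one half of each function is under control: the negative part of [A], and the
    positive parts of [s], [e] and [D g]. The other halves will come from [V_le]. *)
Let iAn : -oo < \int[P]_w (A w)%:E -> P.-integrable setT (EFin \o (A^\-)%R).
Proof.
move=> /(has_expectation_funeneg_lty hA) Any; rewrite -funerneg.
apply/integrableP; split; first exact/measurable_funeneg/measurable_EFinP.
by under eq_integral do rewrite gee0_abs//.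
Qed.

Let isp : \int[rho]_g (s g)%:E < +oo -> rho.-integrable setT (EFin \o (s^\+)%R).
Proof.
move=> /(has_expectation_funepos_lty hs) sy; rewrite -funerpos.
apply/integrableP; split; first exact/measurable_funepos/measurable_EFinP.
by under eq_integral do rewrite gee0_abs//.
Qed.

Let iep : \int[rho]_g e g < +oo -> rho.-integrable setT e^\+.
Proof.
move=> /(has_expectation_funepos_lty he) ey.
apply/integrableP; split; first exact/measurable_funepos.
by under eq_integral do rewrite gee0_abs//.
Qed.

(** Since [e^\+] is integrable, [e g] is below [+oo] for almost every [g], and for such [g] the
    expectation of [D g] is well defined. *)
Let iDp : \int[rho]_g e g < +oo ->
  {ae rho, forall g, P.-integrable setT (EFin \o ((D g)^\+)%R)}.
Proof.
move=> /iep/(integrable_ae measurableT) efin.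
move: efin hD; apply: filterS2 => g /(_ Logic.I) efin hDg; rewrite -funerpos.
have ey : e g < +oo.
  by move: efin; rewrite funeposE; case: (e g) => [r| |]; rewrite ?ltry.
apply/integrableP; split; first exact/measurable_funepos/measurable_EFinP.
under eq_integral do rewrite gee0_abs//.
exact: has_expectation_funepos_lty hDg ey.
Qed.

Let iE : {ae rho, forall g, P.-integrable setT (EFin \o E g)}.
Proof.
move: (integrable_ae measurableT iq); apply: filterS => g /(_ Logic.I) qfin.
apply/integrableP; split; first exact/measurable_EFinP.
under eq_integral do rewrite gee0_abs ?lee_fin//.
by rewrite -/(q g) ltey_eq qfin.
Qed.

(** At a single good [g], [V_le] bounds [- M] by [A^\- + (D g)^\+ + E g] plus a constant. So [M^\-]
    is integrable, which unlocks [M_mean_le0]. *)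
Let iM : -oo < \int[P]_w (A w)%:E -> \int[rho]_g e g < +oo ->
  P.-integrable setT (EFin \o M) /\ \int[P]_w (M w)%:E <= 0.
Proof.
move=> /iAn An /iDp Dp.
have [g [iDg iEg]] : exists g, P.-integrable setT (EFin \o ((D g)^\+)%R) /\
    P.-integrable setT (EFin \o E g).
  by apply: (@ae_exists _ _ _ rho); move: Dp iE; exact: filterS2.
have Mn : \int[P]_w ((M^\-)%R w)%:E < +oo.
  pose b w := ((A^\-)%R w + (D g)^\+%R w + E g w + `|s g + k g|)%R.
  have ib : P.-integrable setT (EFin \o b).
    have ic := finite_measure_integrable_cst P `|s g + k g|%R measurableT.
    have iAD := integrableD measurableT An iDg.
    have := integrableD measurableT (integrableD measurableT iAD iEg) ic.
    by apply: eq_integrable => // w _.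
  case/integrableP: (ib) => _; apply: le_lt_trans.
  apply: ge0_le_integral => //.
  - by move=> w _; rewrite lee_fin.
  - exact/measurable_EFinP/measurable_funrneg.
  - by apply: measurableT_comp => //; exact: measurable_int ib.
  - move=> w _ /=; rewrite lee_fin (le_trans _ (ler_norm _))// /b.
    have := V_le g w; rewrite /V.
    have c0 : (0 < c)%R by rewrite invr_gt0.
    have := E_ge0 g w.
    have An0 : (- A w <= (A^\-)%R w)%R by rewrite /funrneg le_max lexx.
    have An1 : (0 <= (A^\-)%R w)%R by [].
    have Dn0 : (D g w <= ((D g)^\+)%R w)%R by rewrite /funrpos le_max lexx.
    have Dn1 : (0 <= ((D g)^\+)%R w)%R by [].
    have sk0 := ler_norm (s g + k g)%R.
    have sk1 := normr_ge0 (s g + k g)%R.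
    move=> E0 VM; rewrite [leLHS]/funrneg ge_max; apply/andP; split; lra.
have Mp := le_lt_trans (M_mean_le0 Mn) Mn.
have mM' : measurable_fun setT (EFin \o M) by exact/measurable_EFinP.
split; first by apply: integrable_funeposneg; rewrite ?funerpos ?funerneg.
rewrite integralE funerpos funerneg.
rewrite sube_le0//; exact: M_mean_le0.
Qed.

(** Now that [M] is integrable, [V_le] bounds [A] from above at one good [g], and then [D g] from
    below for almost every [g]. *)
Let iAD : -oo < \int[P]_w (A w)%:E -> \int[rho]_g e g < +oo ->
  P.-integrable setT (EFin \o A) /\
  {ae rho, forall g, P.-integrable setT (EFin \o D g)}.
Proof.
move=> Any ey; have [iM' _] := iM Any ey; have Dp := iDp ey.
have ic g := finite_measure_integrable_cst P (s g + k g)%R measurableT.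
have c0 : (0 < c)%R by rewrite invr_gt0.
have iA : P.-integrable setT (EFin \o A).
  have [g [iDg iEg]] : exists g, P.-integrable setT (EFin \o ((D g)^\+)%R) /\
      P.-integrable setT (EFin \o E g).
    by apply: (@ae_exists _ _ _ rho); move: Dp iE; exact: filterS2.
  have iAn' := integrableN (iAn Any).
  have ib := integrableD measurableT (integrableD measurableT iDg iM')
    (integrableD measurableT iEg (ic g)).
  apply: (integrable_sandwich (a := fun w => (- (A^\-)%R w)%R)
    (b := fun w => ((D g)^\+ w + M w + (E g w + (s g + k g)))%R)) => //.
  apply: aeW => w; have := V_le g w; rewrite /V => VM.
  have Dn0 : (D g w <= ((D g)^\+)%R w)%R by rewrite /funrpos le_max lexx.
  apply/andP; split; last lra.
  by rewrite lerNl /funrneg le_max lexx.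
split => //; move: Dp iE; apply: filterS2 => g iDg iEg.
have ib := integrableB measurableT iA (integrableD measurableT iM'
  (integrableD measurableT iEg (ic g))).
apply: (integrable_sandwich (b := ((D g)^\+)%R)
  (a := fun w => (A w - (M w + (E g w + (s g + k g))))%R)) => //.
apply: aeW => w; have := V_le g w; rewrite /V => VM.
apply/andP; split; first lra.
by rewrite /funrpos le_max lexx.
Qed.

(** Integrate [V_le] over [w] at fixed [g], and drop the mean of [M], which is at most 0. *)
Let pointwise_comparison : -oo < \int[P]_w (A w)%:E -> \int[rho]_g e g < +oo ->
  {ae rho, forall g, [/\ e g \is a fin_num, q g \is a fin_num &
    (fine (\int[P]_w (A w)%:E) <= s g + fine (e g) + k g + fine (q g) - c)%R]}.
Proof.
move=> Any ey; have [iM' M0] := iM Any ey; have [iA iD] := iAD Any ey.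
move: iD iE; apply: filterS2 => g iDg iEg.
have fe : e g \is a fin_num by exact: (integrable_fin_num measurableT iDg).
have fq : q g \is a fin_num by exact: (integrable_fin_num measurableT iEg).
have fM : \int[P]_w (M w)%:E \is a fin_num.
  exact: (integrable_fin_num measurableT iM').
have fA : \int[P]_w (A w)%:E \is a fin_num.
  exact: (integrable_fin_num measurableT iA).
split => //.
have ic := finite_measure_integrable_cst P (s g + k g - c)%R measurableT.
have iDM := integrableD measurableT iDg iM'.
have iEc := integrableD measurableT iEg ic.
have ib := integrableD measurableT iDM iEc.
have := @ae_le_integral _ _ _ P A
  (fun w => ((D g w + M w) + (E g w + (s g + k g - c)))%R) iA ib.
have -> : \int[P]_w ((D g w + M w) + (E g w + (s g + k g - c)))%:E =
    \int[P]_w (D g w)%:E + \int[P]_w (M w)%:E +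
    (\int[P]_w (E g w)%:E + \int[P]_w (s g + k g - c)%:E).
  rewrite -(integralD measurableT iDg iM') -(integralD measurableT iEg ic).
  by rewrite -(integralD measurableT iDM iEc).
rewrite integral_cst_probability -/(e g) -/(q g) => le.
have {le} : \int[P]_w (A w)%:E <=
    e g + \int[P]_w (M w)%:E + (q g + (s g + k g - c)%:E).
  by apply: le; apply: aeW => w; have := V_le g w; rewrite /V; lra.
move: M0; rewrite -(fineK fA) -(fineK fe) -(fineK fq) -(fineK fM) -!EFinD !lee_fin.
by rewrite /=; lra.
Qed.

(** Apart from trivial infinite cases, [pointwise_comparison] is integrated over [g], after it has
    itself supplied the missing lower bounds on [s] and [e]. *)
Lemma supermartingale_comparison :
  \int[P]_w (A w)%:E <= \int[rho]_g (s g)%:E + \int[rho]_g e g + \int[rho]_g (k g)%:E.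
Proof.
have fk : \int[rho]_g (k g)%:E \is a fin_num.
  exact: (integrable_fin_num measurableT ik).
have [->|] := eqVneq (\int[P]_w (A w)%:E) -oo; first exact: leNye.
rewrite -ltNye => Any.
have [sey|] := eqVneq (\int[rho]_g (s g)%:E + \int[rho]_g e g) +oo.
  by rewrite sey -(fineK fk) leey.
rewrite -ltey => sey.
(* [hse] rules out a sum of opposite infinities, whose value [-oo] would also be below [+oo]. *)
have [sy ey] : \int[rho]_g (s g)%:E < +oo /\ \int[rho]_g e g < +oo.
  move: hse sey.
  by case: (\int[rho]_g (s g)%:E) => [r| |]; case: (\int[rho]_g e g) => [r'| |];
    rewrite ?ltry.
have [iA _] := iAD Any ey.
have fA : \int[P]_w (A w)%:E \is a fin_num.
  exact: (integrable_fin_num measurableT iA).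
set a := fine (\int[P]_w (A w)%:E).
(* [e] and [q] are known to be finite almost everywhere only; these are real-valued versions. *)
pose er := fine \o e; pose qr := fine \o q.
have pw := pointwise_comparison Any ey.
have ler : {ae rho, forall g, (a <= s g + er g + k g + qr g - c)%R}.
  by move: pw; apply: filterS => g [].
have mer : measurable_fun setT er by exact: measurableT_comp.
have mqr : measurable_fun setT qr by exact: measurableT_comp.
have eer : ae_eq rho setT e (EFin \o er).
  by move: pw; apply: filterS => g [fe _ _] _; rewrite /er /= fineK.
have qqr : ae_eq rho setT q (EFin \o qr).
  by move: pw; apply: filterS => g [_ fq _] _; rewrite /qr /= fineK.
have iqr : rho.-integrable setT (EFin \o qr).
  apply: le_integrable iq => //; first exact/measurable_EFinP.
  move=> g _; rewrite /qr /=; move: (q_ge0 g).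
  by case: (q g) => [r| |] //= _; rewrite leey.
have ierp : rho.-integrable setT (EFin \o (er^\+)%R).
  apply: le_integrable (iep ey) => //.
    exact/measurable_EFinP/measurable_funrpos.
  move=> g _; rewrite /er /= /funrpos /= funeposE.
  case: (e g) => [r| |] /=; rewrite ?maxxx ?normr0 ?leey ?abse_ge0//.
  by rewrite -EFin_max.
have ic r := finite_measure_integrable_cst rho r measurableT.
(* [ler] bounds [s] from below using only the positive part of [er]. Once [s] is integrable, the
   same inequality bounds [er] from below. *)
have is_ : rho.-integrable setT (EFin \o s).
  have ib := integrableB measurableT (ic (a + c)%R) (integrableD measurableT ierp
    (integrableD measurableT ik iqr)).
  apply: (integrable_sandwich (b := (s^\+)%R)
    (a := fun g => ((a + c) - ((er^\+)%R g + (k g + qr g)))%R)) => //.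
    exact: isp.
  move: ler; apply: filterS => g le.
  have er0 : (er g <= (er^\+)%R g)%R by rewrite /funrpos le_max lexx.
  by apply/andP; split; [lra|rewrite /funrpos le_max lexx].
have ie : rho.-integrable setT (EFin \o er).
  have ib := integrableB measurableT (ic (a + c)%R) (integrableD measurableT is_
    (integrableD measurableT ik iqr)).
  apply: (integrable_sandwich (b := (er^\+)%R)
    (a := fun g => ((a + c) - (s g + (k g + qr g)))%R)) => //.
  move: ler; apply: filterS => g le.
  by apply/andP; split; [lra|rewrite /funrpos le_max lexx].
have ise := integrableD measurableT is_ ie.
have ikq := integrableD measurableT ik iqr.
have isek := integrableD measurableT ise ikq.
have := @ae_le_integral _ _ _ rho (cst (a + c)%R)
  (fun g => ((s g + er g) + (k g + qr g))%R) (ic _) isek.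
rewrite integral_cst_probability => le.
have {le} : (a + c)%:E <= \int[rho]_g (s g)%:E + \int[rho]_g (er g)%:E +
    (\int[rho]_g (k g)%:E + \int[rho]_g (qr g)%:E).
  rewrite -(integralD measurableT is_ ie) -(integralD measurableT ik iqr).
  rewrite -(integralD measurableT ise ikq); apply: le.
  by move: ler; apply: filterS => g /=; lra.
have -> : \int[rho]_g e g = \int[rho]_g (er g)%:E.
  by apply: ae_eq_integral => //; exact/measurable_EFinP.
have qrE : \int[rho]_g (qr g)%:E <= c%:E.
  rewrite (_ : \int[rho]_g (qr g)%:E = \int[rho]_g q g)//.
  by apply: ae_eq_integral => //; [exact/measurable_EFinP|exact: ae_eq_sym].
have fs := integrable_fin_num measurableT is_.
have fer := integrable_fin_num measurableT ie.
have fqr := integrable_fin_num measurableT iqr.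
move: qrE; rewrite -(fineK fA) -/a -(fineK fs) -(fineK fer) -(fineK fqr) -(fineK fk).
by rewrite -!EFinD !lee_fin; lra.
Qed.

End comparison.

(** * The free energy of a run *)

Section process.
Context (R : realType) (Z : Type) dG (G : measurableType dG)
  dB (B : measurableType dB) (incl : G -> B).
Variables (lambda : R) (L : Z -> B -> R) (delta : Z -> G -> B -> R).
Hypothesis lambda_gt0 : (0 < lambda)%R.
Hypothesis mL : forall x, measurable_fun setT (L x).
Hypothesis mLG : forall x, measurable_fun setT (L x \o incl).
Hypothesis mdelta : forall x, measurable_fun setT (fun p : G * B => delta x p.1 p.2).
Variables (pi : probability G R) (pihat : probability G R -> probability B R).
Hypothesis variance_ineq : forall rho,
  online_variance_bound incl lambda L delta rho (pihat rho).
Variable z : nat -> Z.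

Let S i (h : i.-tuple B) g := cumulative_loss incl L delta z h g.
(** Primed quantities are those at time [i.+1], as functions of the pair of a history and a new draw
    [b]: disintegration takes place on this product, not on [i.+1]-tuples. *)
Let S' i (h : i.-tuple B) b g := (S h g + (L (z i) (incl g) + delta (z i) g b))%R.
Let kappa i (h : i.-tuple B) := predictor_law incl lambda L delta pi pihat z h.

Definition partition_function i (h : i.-tuple B) : \bar R :=
  \int[pi]_g (expR (- (lambda * cumulative_loss incl L delta z h g)))%:E.

Definition past_loss i (h : i.-tuple B) : R := (\sum_(j < i) L (z j) (tnth h j))%R.

Definition free_energy i (h : i.-tuple B) : R :=
  (past_loss h + lambda^-1 * ln (fine (partition_function h)))%R.

Let W' i (h : i.-tuple B) b : \bar R := \int[pi]_g (expR (- (lambda * S' h b g)))%:E.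
Let M' i (h : i.-tuple B) b : R :=
  (past_loss h + L (z i) b + lambda^-1 * ln (fine (W' h b)))%R.

Let mS i : measurable_fun setT (fun p : i.-tuple B * G => S p.1 p.2).
Proof.
apply: measurable_sum => j; apply: measurable_funD.
  exact: (measurableT_comp (mLG (z j)) measurable_snd).
have mp : measurable_fun setT (fun p : i.-tuple B * G => (p.2, tnth p.1 j)).
  apply: measurable_fun_pair => //.
  exact: (measurableT_comp (measurable_tnth j) measurable_fst).
exact: (measurableT_comp (mdelta (z j)) mp).
Qed.

Let mS' i : measurable_fun setT (fun p : (i.-tuple B * B) * G => S' p.1.1 p.1.2 p.2).
Proof.
apply: measurable_funD; last apply: measurable_funD.
- have mp : measurable_fun setT (fun p : (i.-tuple B * B) * G => (p.1.1, p.2)).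
    by apply: measurable_fun_pair => //; exact: measurableT_comp.
  exact: (measurableT_comp (@mS i) mp).
- exact: (measurableT_comp (mLG (z i)) measurable_snd).
- have mp : measurable_fun setT (fun p : (i.-tuple B * B) * G => (p.2, p.1.2)).
    by apply: measurable_fun_pair => //; exact: measurableT_comp.
  exact: (measurableT_comp (mdelta (z i)) mp).
Qed.

Let mS1 i (h : i.-tuple B) : measurable_fun setT (S h).
Proof. exact: (measurableT_comp (@mS i) (measurable_pair1 h)). Qed.

Let mS'1 i (h : i.-tuple B) b : measurable_fun setT (S' h b).
Proof. exact: (measurableT_comp (@mS' i) (measurable_pair1 (h, b))). Qed.

Let mW i : measurable_fun setT (@partition_function i).
Proof.
apply: (@measurable_fun_fubini_tonelli_F _ _ _ _ _ pi
  (fun p : i.-tuple B * G => (expR (- (lambda * S p.1 p.2)))%:E)).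
  apply/measurable_EFinP; apply: measurableT_comp => //.
  apply: measurableT_comp => //.
  exact: (measurable_funM (measurable_cst lambda) (@mS i)).
by move=> p; rewrite lee_fin expR_ge0.
Qed.

Let mW' i : measurable_fun setT (fun p : i.-tuple B * B => W' p.1 p.2).
Proof.
apply: (@measurable_fun_fubini_tonelli_F _ _ _ _ _ pi
  (fun p : (i.-tuple B * B) * G => (expR (- (lambda * S' p.1.1 p.1.2 p.2)))%:E)).
  apply/measurable_EFinP; apply: measurableT_comp => //.
  apply: measurableT_comp => //.
  exact: (measurable_funM (measurable_cst lambda) (@mS' i)).
by move=> p; rewrite lee_fin expR_ge0.
Qed.

Let mpast i : measurable_fun setT (@past_loss i).
Proof.
apply: measurable_sum => j.
exact: (measurableT_comp (mL (z j)) (measurable_tnth j)).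
Qed.

Let mM i : measurable_fun setT (@free_energy i).
Proof.
apply: (measurable_funD (@mpast i)).
apply: (measurable_funM (measurable_cst lambda^-1%R)).
apply: measurableT_comp => //.
exact: (measurableT_comp (fine_measurable measurableT) (@mW i)).
Qed.

Let mM' i : measurable_fun setT (fun p : i.-tuple B * B => M' p.1 p.2).
Proof.
apply: measurable_funD; first apply: measurable_funD.
- exact: (measurableT_comp (@mpast i) measurable_fst).
- exact: (measurableT_comp (mL (z i)) measurable_snd).
- apply: (measurable_funM (measurable_cst lambda^-1%R)).
  apply: measurableT_comp => //.
  exact: (measurableT_comp (fine_measurable measurableT) (@mW' i)).
Qed.

Lemma partition_function_gt0 i (h : i.-tuple B) : 0 < partition_function h.
Proof.
apply: (integral_expR_gt0 pi (f := fun g => - (lambda * S h g))%R).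
apply: measurableT_comp => //.
exact: (measurable_funM (measurable_cst lambda) (@mS1 i h)).
Qed.

Let W'_gt0 i (h : i.-tuple B) b : 0 < W' h b.
Proof.
apply: (integral_expR_gt0 pi (f := fun g => - (lambda * S' h b g))%R).
apply: measurableT_comp => //.
exact: (measurable_funM (measurable_cst lambda) (@mS'1 i h b)).
Qed.

(* The first law is [pihat pi] and not [pihat] of a Gibbs law, hence the two
   cases. *)
Let kappaE i (h : i.-tuple B) : partition_function h < +oo ->
  exists2 rho, kappa h = pihat rho &
  forall f : G -> \bar R, (forall g, 0 <= f g) -> measurable_fun setT f ->
  \int[rho]_g f g = \int[pi]_g (f g *
    (expR (- (lambda * S h g)) / fine (partition_function h))%:E).
Proof.
move=> Wy; rewrite /kappa /predictor_law; case: eqP => [i0|_].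
  exists pi => // f f0 mf; apply: eq_integral => g _.
  have S0 g' : S h g' = 0%R.
    by rewrite /S /cumulative_loss; subst i; rewrite big_ord0.
  rewrite S0 mulr0 oppr0 expR0 (_ : partition_function h = 1) ?divr1 ?mule1//.
  rewrite /partition_function -[RHS](integral_cst_probability pi 1).
  by apply: eq_integral => g' _; rewrite -/(S h g') S0 mulr0 oppr0 expR0.
exists (gibbs pi (fun g => lambda * S h g)%R) => // f f0 mf.
rewrite (gibbsE _ Wy)//.
exact: (measurable_funM (measurable_cst lambda) (mS1 h)).
Qed.

(** Under the Gibbs density, the exponential moment in the variance inequality is
    [expR (lambda * L (z i) b)] times the ratio of the new partition function to the old one. Its
    logarithm is [lambda] times the increment of the free energy. *)
Let variance_step i (h : i.-tuple B) (F := fun b =>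
    if W' h b == +oo then +oo else (lambda * (M' h b - free_energy h))%:E) :
  partition_function h < +oo ->
  has_expectation (kappa h) F /\ \int[kappa h]_b F b <= 0.
Proof.
move=> Wy; have [rho -> rhoE] := kappaE Wy.
have Wfin : partition_function h \is a fin_num.
  by rewrite ge0_fin_numE// ltW// partition_function_gt0.
have W0 : (0 < fine (partition_function h))%R.
  by rewrite fine_gt0// partition_function_gt0.
have [] := variance_ineq rho (z i).
set F0 := (fun b => lne _); suff -> : F0 = F by [].
apply/funext => b; rewrite /F0 /F unlock.
rewrite rhoE; last 2 first.
- by move=> g; rewrite lee_fin expR_ge0.
- apply/measurable_EFinP; apply: measurableT_comp => //.
  apply: measurable_funM => //; apply: measurable_funB.
    by apply: measurable_funB => //; exact: mLG.
  exact: (measurableT_comp (mdelta (z i)) (measurable_pair2 b)).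
have -> : \int[pi]_g ((expR
        (lambda * (L (z i) b - L (z i) (incl g) - delta (z i) g b)))%:E *
      (expR (- (lambda * S h g)) / fine (partition_function h))%:E) =
    (expR (lambda * L (z i) b) / fine (partition_function h))%:E * W' h b.
  rewrite -ge0_integralZl//.
  - apply: eq_integral => g _; rewrite -!EFinM; congr EFin.
    rewrite mulrA -expRD [RHS]mulrAC -expRD; congr (expR _ / _)%R.
    by rewrite /S'; ring.
  - apply/measurable_EFinP; apply: measurableT_comp => //.
    apply: measurableT_comp => //.
    exact: (measurable_funM (measurable_cst lambda) (mS'1 h b)).
  - by rewrite lee_fin divr_ge0// ?expR_ge0// ltW.
have c0 : (0 < expR (lambda * L (z i) b) / fine (partition_function h))%R.
  by rewrite divr_gt0 ?expR_gt0.
(* If the new partition function is infinite, so is the logarithm, whereas [M'] is a real number: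
   hence the case distinction in [F]. *)
case: eqP => [->|/eqP W'y]; first by rewrite gt0_muley ?lte_fin.
have W'fin : W' h b \is a fin_num by rewrite ge0_fin_numE ?ltey// ltW.
have W'0 : (0 < fine (W' h b))%R by rewrite fine_gt0// W'_gt0 ltey.
rewrite -(fineK W'fin) -EFinM lne_EFin; last exact: mulr_gt0.
rewrite lnM ?posrE// ln_div ?posrE ?expR_gt0// expRK; congr EFin.
by rewrite /M' /free_energy /=; field; rewrite gt_eqF.
Qed.

Context dO (Omega : measurableType dO) (P : probability Omega R).
Variables (ghat : nat -> {RV P >-> B}) (n : nat).
Hypothesis run : seqrand_run incl lambda L delta pi pihat z ghat n.

Let hist i : Omega -> i.-tuple B := history ghat i.

Let mhist i : measurable_fun setT (@hist i).
Proof.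
apply/measurable_fun_tnthP => j.
rewrite (_ : _ \o _ = ghat j)//.
by apply/funext => w /=; rewrite tnth_mktuple.
Qed.

Let mghat i : measurable_fun setT (ghat i).
Proof. exact: measurable_funP. Qed.

Let S_history i w g : S (hist i.+1 w) g = S' (hist i w) (ghat i w) g.
Proof.
rewrite /S' /S /cumulative_loss big_ord_recr /= tnth_mktuple; congr (_ + _)%R.
by apply: eq_bigr => j _; rewrite !tnth_mktuple.
Qed.

Let W_history i w : partition_function (hist i.+1 w) = W' (hist i w) (ghat i w).
Proof. by apply: eq_integral => g _; rewrite -/(S _ _) S_history. Qed.

Let M_history i w : free_energy (hist i.+1 w) = M' (hist i w) (ghat i w).
Proof.
rewrite /free_energy /M' W_history; congr (_ + _)%R.
rewrite /past_loss big_ord_recr /= tnth_mktuple; congr (_ + _)%R.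
by apply: eq_bigr => j _; rewrite !tnth_mktuple.
Qed.

Let disint i (f : i.-tuple B * B -> \bar R) : (i < n)%N -> (forall p, 0 <= f p) ->
  measurable_fun setT f ->
  \int[P]_w f (hist i w, ghat i w) =
    \int[P]_w \int[kappa (hist i w)]_b f (hist i w, b).
Proof.
move=> lein f0 mf; have [mk rect] := run lein.
exact: (@disintegration _ _ _ _ _ _ _ _ (@kappa i) (@mhist i) mk P _ (mghat i)
  rect).
Qed.

Let mint i (f : i.-tuple B * B -> \bar R) : (i < n)%N -> (forall p, 0 <= f p) ->
  measurable_fun setT f ->
  measurable_fun setT (fun w => \int[kappa (hist i w)]_b f (hist i w, b)).
Proof.
move=> lein f0 mf; have [mk _] := run lein.
exact: (@measurable_fun_integral_probability _ _ _ _ _ _ _ _ (@kappa i)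
  (@mhist i) mk).
Qed.

(* The negative part is assumed integrable at time [i] only: integrability at
   the earlier times follows from [supermartingale_step]. *)
Lemma free_energy_mean_le0 i : (i <= n)%N ->
  {ae P, forall w, partition_function (hist i w) < +oo} /\
  (\int[P]_w (((@free_energy i \o hist i)^\-)%R w)%:E < +oo ->
   \int[P]_w (((@free_energy i \o hist i)^\+)%R w)%:E <=
   \int[P]_w (((@free_energy i \o hist i)^\-)%R w)%:E).
Proof.
elim: i => [_|i ih lein].
  have S0 (h : 0.-tuple B) g : S h g = 0%R by rewrite /S /cumulative_loss big_ord0.
  have W1 (h : 0.-tuple B) : partition_function h = 1.
    rewrite /partition_function -[RHS](integral_cst_probability pi 1).
    by apply: eq_integral => g _; rewrite -/(S h g) S0 mulr0 oppr0 expR0.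
  split; first by apply: aeW => w; rewrite W1 ltry.
  have M0 w : free_energy (hist 0 w) = 0%R.
    by rewrite /free_energy W1 /= ln1 mulr0 addr0 /past_loss big_ord0.
  rewrite !integral0_eq// => w _; rewrite /funrpos /funrneg /= M0 ?oppr0 maxxx//.
have [Wy ihM] := ih (ltnW lein).
(* The one-step estimate at a fixed history; it is integrated over histories below. *)
have step w : partition_function (hist i w) < +oo -> _ :=
  fun Wyw => let: conj h1 h2 := variance_step Wyw in
    supermartingale_step lambda_gt0
      (measurableT_comp (@mM' i) (measurable_pair1 (hist i w)))
      (measurableT_comp (@mW' i) (measurable_pair1 (hist i w))) h1 h2.
split.
  (* The indicator of an infinite partition function after the draw. By disintegration its
     expectation is 0, since it is conditionally null for almost every history. *)
  pose bad (p : i.-tuple B * B) : \bar R := if W' p.1 p.2 == +oo then 1 else 0.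
  have bad0 p : 0 <= bad p by rewrite /bad; case: ifP.
  have mbad : measurable_fun setT bad.
    apply: measurable_fun_ifT => //; apply: (measurable_fun_bool true).
    rewrite [X in measurable X](_ : _ =
        setT `&` (fun p => W' p.1 p.2) @^-1` [set +oo]).
      exact: (@mW' i) (emeasurable_set1 _).
    by congr (_ `&` _); apply/seteqP; split => b /= /eqP.
  have bad_int0 : \int[P]_w bad (hist i w, ghat i w) = 0.
    rewrite (disint lein bad0 mbad).
    rewrite -(integral0 P setT); apply: ae_eq_integral => //.
      exact: mint.
    move: Wy; apply: filterS => w /step[good _ _] _ /=.
    rewrite -[RHS](integral0 (kappa (hist i w)) setT); apply: ae_eq_integral => //.
      exact: (measurableT_comp mbad (measurable_pair1 _)).
    by move: good; apply: filterS => b /negbTE Wb _; rewrite /bad /= Wb.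
  have mh : measurable_fun setT (fun w => (hist i w, ghat i w)).
    exact: (measurable_fun_pair (@mhist i) (mghat i)).
  have /(ae_eq_integral_abs P measurableT (measurableT_comp mbad mh)) :
      \int[P]_w `|bad (hist i w, ghat i w)| = 0.
    by rewrite -[RHS]bad_int0; apply: eq_integral => w _; rewrite gee0_abs.
  apply: filterS => w /(_ Logic.I); rewrite W_history /bad /= ltey.
  by case: eqP => // _ /eqP; rewrite onee_eq0.
pose m' (p : i.-tuple B * B) := M' p.1 p.2.
pose fp := EFin \o (m'^\+)%R; pose fn := EFin \o (m'^\-)%R.
have fp0 p : 0 <= fp p by rewrite lee_fin.
have fn0 p : 0 <= fn p by rewrite lee_fin.
have mm' : measurable_fun setT m' by exact: (@mM' i).
have mfp : measurable_fun setT fp by exact/measurable_EFinP/measurable_funrpos.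
have mfn : measurable_fun setT fn by exact/measurable_EFinP/measurable_funrneg.
have EMn : \int[P]_w (((@free_energy i.+1 \o hist i.+1)^\-)%R w)%:E =
    \int[P]_w \int[kappa (hist i w)]_b fn (hist i w, b).
  rewrite -(disint lein fn0 mfn); apply: eq_integral => w _.
  by rewrite /funrneg /= M_history.
have EMp : \int[P]_w (((@free_energy i.+1 \o hist i.+1)^\+)%R w)%:E =
    \int[P]_w \int[kappa (hist i w)]_b fp (hist i w, b).
  rewrite -(disint lein fp0 mfp); apply: eq_integral => w _.
  by rewrite /funrpos /= M_history.
rewrite EMn EMp => fn_lty.
have mMh : measurable_fun setT (@free_energy i \o hist i).
  exact: measurableT_comp (@mM i) (@mhist i).
have mMn : measurable_fun setT (EFin \o ((@free_energy i \o hist i)^\-)%R).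
  exact/measurable_EFinP/measurable_funrneg.
have mMp : measurable_fun setT (EFin \o ((@free_energy i \o hist i)^\+)%R).
  exact/measurable_EFinP/measurable_funrpos.
have ifn0 w : 0 <= \int[kappa (hist i w)]_b fn (hist i w, b) by exact: integral_ge0.
have ifp0 w : 0 <= \int[kappa (hist i w)]_b fp (hist i w, b) by exact: integral_ge0.
(* The mean negative part does not decrease with time, so its finiteness passes from [i.+1] back to
   [i], where the induction hypothesis applies. *)
have Mn_le : \int[P]_w (((@free_energy i \o hist i)^\-)%R w)%:E <=
    \int[P]_w \int[kappa (hist i w)]_b fn (hist i w, b).
  apply: ae_ge0_le_integral => //.
  - by move=> w _; rewrite lee_fin.
  - exact: mint.
  - by move: Wy; apply: filterS => w /step[_ + _] _.
have Mn_lty := le_lt_trans Mn_le fn_lty.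
have Mp_le := ihM Mn_lty.
have Mn0 : 0 <= \int[P]_w (((@free_energy i \o hist i)^\-)%R w)%:E.
  by apply: integral_ge0 => w _; rewrite lee_fin.
have le : \int[P]_w (((@free_energy i \o hist i)^\-)%R w)%:E +
      \int[P]_w \int[kappa (hist i w)]_b fp (hist i w, b) <=
    \int[P]_w (((@free_energy i \o hist i)^\+)%R w)%:E +
      \int[P]_w \int[kappa (hist i w)]_b fn (hist i w, b).
  rewrite -!ge0_integralD//; first last.
  - exact: mint.
  - by move=> w _; rewrite lee_fin.
  - exact: mint.
  - by move=> w _; rewrite lee_fin.
  apply: ae_ge0_le_integral => //.
  - by move=> w _; rewrite adde_ge0// lee_fin.
  - by apply: emeasurable_funD => //; exact: mint.
  - by move=> w _; rewrite adde_ge0// lee_fin.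
  - by apply: emeasurable_funD => //; exact: mint.
  - by move: Wy; apply: filterS => w /step[_ _ +] _.
(* The finite mean of the negative part at time [i] is added to both sides; [le] and then [Mp_le]
   conclude. *)
rewrite -(leeD2lE (x := \int[P]_w (((@free_energy i \o hist i)^\-)%R w)%:E)).
  by apply: le_trans le _; exact: leeD2r.
by rewrite ge0_fin_numE.
Qed.

Lemma measurable_fixed_loss : measurable_fun setT (fixed_loss incl L z n).
Proof. by apply: measurable_sum => i; exact: mLG. Qed.

Lemma measurable_total_delta :
  measurable_fun setT (fun p : G * Omega => total_delta delta z ghat n p.1 p.2).
Proof.
apply: measurable_sum => i.
have mp : measurable_fun setT (fun p : G * Omega => (p.1, ghat i p.2)).
  apply: measurable_fun_pair => //.
  exact: (measurableT_comp (mghat i) measurable_snd).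
exact: (measurableT_comp (mdelta (z i)) mp).
Qed.

(** The second hypothesis says that [rho] weighted by [expR (- (lambda * k g))] is at most [pi],
    which covers both a log-density and the constant of the uniform case. With [M] the free energy,
    the exponential in [expV_le1] is the Gibbs density times this weight, so its integral is at most
    the total mass of the Gibbs law. *)
Lemma seqrand_bound (rho : probability G R) (k : G -> R) :
  rho.-integrable setT (EFin \o k) ->
  (forall f : G -> \bar R, (forall g, 0 <= f g) -> measurable_fun setT f ->
    \int[rho]_g (f g * (expR (- (lambda * k g)))%:E) <= \int[pi]_g f g) ->
  has_expectation P (EFin \o total_loss L z ghat n) ->
  has_expectation rho (EFin \o fixed_loss incl L z n) ->
  {ae rho, forall g, has_expectation P (EFin \o total_delta delta z ghat n g)} ->
  has_expectation rho (fun g => \int[P]_w (total_delta delta z ghat n g w)%:E) ->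
  \int[rho]_g (fixed_loss incl L z n g)%:E +?
    \int[rho]_g \int[P]_w (total_delta delta z ghat n g w)%:E ->
  \int[P]_w (total_loss L z ghat n w)%:E <=
    \int[rho]_g (fixed_loss incl L z n g)%:E +
    \int[rho]_g \int[P]_w (total_delta delta z ghat n g w)%:E +
    \int[rho]_g (k g)%:E.
Proof.
move=> ik rho_pi hA hs hD he hse.
have [Wy EM] := free_energy_mean_le0 (leqnn n).
apply: (@supermartingale_comparison _ _ _ _ _ P rho lambda
  (@free_energy n \o hist n)) => //.
- exact: measurableT_comp (@mM n) (@mhist n).
- apply: measurable_sum => i; exact: (measurableT_comp (mL (z i)) (mghat i)).
- exact: measurable_fixed_loss.
- exact: measurable_total_delta.
move: Wy; apply: filterS => w Wy.
set W := partition_function (hist n w) in Wy.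
have W0 : 0 < W by exact: partition_function_gt0.
have Wfin : W \is a fin_num by rewrite ge0_fin_numE// ltW.
have fW0 : (0 < fine W)%R by rewrite fine_gt0// W0.
(* The density with respect to [pi] of the Gibbs law after all [n] draws. *)
pose f g := (expR (- (lambda * S (hist n w) g)) / fine W)%:E.
have mexp : measurable_fun setT (fun g => (expR (- (lambda * S (hist n w) g)))).
  apply: measurableT_comp => //; apply: measurableT_comp => //.
  exact: (measurable_funM (measurable_cst lambda) (mS1 (hist n w))).
have f0 g : 0 <= f g by rewrite lee_fin divr_ge0 ?expR_ge0// ltW.
have mf : measurable_fun setT f.
  apply/measurable_EFinP.
  exact: (measurable_funM mexp (measurable_cst (fine W)^-1%R)).
have SE g : S (hist n w) g =
    (fixed_loss incl L z n g + total_delta delta z ghat n g w)%R.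
  rewrite /S /cumulative_loss /fixed_loss /total_delta -big_split /=.
  by apply: eq_bigr => j _; rewrite tnth_mktuple.
have past_lossE : past_loss (hist n w) = total_loss L z ghat n w.
  by apply: eq_bigr => j _; rewrite tnth_mktuple.
have intf : \int[pi]_g f g = 1.
  rewrite /f; under eq_integral do rewrite mulrC EFinM.
  rewrite ge0_integralZl//.
  - rewrite -/(partition_function (hist n w)) -/W -(fineK Wfin) -EFinM mulVf//.
    by rewrite gt_eqF.
  - exact/measurable_EFinP.
  - by rewrite lee_fin invr_ge0 ltW.
rewrite -intf; apply: le_trans (rho_pi f f0 mf).
rewrite le_eqVlt; apply/orP; left; apply/eqP; apply: eq_integral => g _.
rewrite /f -EFinM; congr EFin.
rewrite /= /free_energy past_lossE -/W mulrAC -expRD.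
have -> : ((fine W)^-1 = expR (- ln (fine W)))%R by rewrite expRN lnK ?posrE.
rewrite -expRD SE; congr expR.
by field; rewrite gt_eqF.
Qed.

End process.

(** * The two choices of the comparison law *)

Section kullback_leibler.
Local Open Scope charge_scope.
Context d (T : measurableType d) (R : realType) (rho pi : probability T R).
Hypothesis rho_pi : rho `<< pi.

Let f := Radon_Nikodym_SigmaFinite.f rho pi.
(** A version of the density that is finite and nonnegative at every point, unlike the derivative in
    [KL], for which this is only known almost everywhere. *)
Let r x : R := fine (f x).

Let fr x : f x = (r x)%:E.
Proof. by rewrite fineK//; exact: Radon_Nikodym_SigmaFinite.f_fin_num. Qed.

Let r_ge0 x : (0 <= r x)%R.
Proof. by apply: fine_ge0; exact: Radon_Nikodym_SigmaFinite.f_ge0. Qed.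

Let mf : measurable_fun setT f.
Proof.
exact: (measurable_int _ (Radon_Nikodym_SigmaFinite.f_integrable rho_pi)).
Qed.

Let mr : measurable_fun setT r. Proof. exact: measurableT_comp. Qed.

Let rhoE A : measurable A -> rho A = \int[pi]_(x in A) (r x)%:E.
Proof.
move=> mA; rewrite (Radon_Nikodym_SigmaFinite.f_integral rho_pi)//.
by apply: eq_integral => x _; exact: fr.
Qed.

Let r_gt0 : {ae rho, forall x, (0 < r x)%R}.
Proof.
have mN : measurable (r @^-1` [set 0%R]).
  by rewrite -[X in measurable X]setTI; exact: mr.
exists (r @^-1` [set 0%R]); split => //.
  rewrite rhoE//; apply: integral0_eq => x /= ->//.
move=> x /= /negP; rewrite -leNgt => rx.
by apply/eqP; rewrite eq_le rx r_ge0.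
Qed.

(** The two versions of the density agree [pi]-almost everywhere, hence [rho]-almost everywhere by
    domination. There [r] is positive, so that [lne] and [ln] coincide. *)
Lemma KL_lnE : KL rho pi = \int[rho]_x (ln (r x))%:E.
Proof.
rewrite /KL asboolT//.
have mRN : measurable_fun setT ('d (charge_of_finite_measure rho) '/d pi) by [].
apply: ae_eq_integral => //.
- rewrite (_ : (fun x => lne _) = (fun x =>
      if ('d (charge_of_finite_measure rho) '/d pi) x <= 0 then -oo
      else (ln (fine (('d (charge_of_finite_measure rho) '/d pi) x)))%:E));
    last first.
    apply/funext => x.
    have := Radon_Nikodym_fin_num (nu := charge_of_finite_measure rho) x rho_pi.
    by case: (('d _ '/d _) x).
  apply: measurable_fun_ifT => //.
    exact: measurable_fun_lee.
  by apply/measurable_EFinP; apply: measurableT_comp => //; exact: measurableT_comp.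
- by apply/measurable_EFinP; exact: measurableT_comp.
have := ae_eq_Radon_Nikodym_SigmaFinite rho_pi measurableT.
move=> /(measure_dominates_ae_eq measurableT rho_pi).
move: r_gt0; apply: filterS2 => x rx /(_ Logic.I) <- _.
by rewrite -/f fr lne_EFin.
Qed.

(** The factor [expR (- ln (r x))] cancels the density where [r] is positive. Where [r] vanishes the
    mass of [pi] is lost, hence an inequality. *)
Lemma KL_change_measure (h : T -> \bar R) : (forall x, 0 <= h x) ->
  measurable_fun setT h ->
  \int[rho]_x (h x * (expR (- ln (r x)))%:E) <= \int[pi]_x h x.
Proof.
move=> h0 mh.
have mexp : measurable_fun setT (fun x => (expR (- ln (r x)))%:E).
  apply/measurable_EFinP; apply: measurableT_comp => //.
  by apply: measurableT_comp => //; exact: measurableT_comp.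
rewrite (ge0_integral_density mr rhoE); last 2 first.
- by move=> x; rewrite mule_ge0// lee_fin expR_ge0.
- exact: emeasurable_funM.
apply: ge0_le_integral => //.
- by move=> x _; rewrite !mule_ge0// lee_fin ?expR_ge0.
- by apply: emeasurable_funM; [exact: emeasurable_funM|exact/measurable_EFinP].
move=> x _; rewrite -muleA -EFinM -[leRHS]mule1 lee_wpmul2l// lee_fin.
have [r0|r0] := ltP 0%R (r x); last first.
  by rewrite (_ : r x = 0)%R ?mulr0//; apply/eqP; rewrite eq_le r0 r_ge0.
by rewrite expRN lnK ?posrE// mulVf// gt_eqF.
Qed.

(** The negative part of [ln r] is at most [expR (- ln r)], whose [rho]-integral is at most 1. The
    divergence is thus well defined, and its being finite controls the positive part. *)
Lemma KL_lty_integrable : KL rho pi < +oo ->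
  rho.-integrable setT (fun x => (ln (r x))%:E).
Proof.
rewrite KL_lnE => KLy.
have mln : measurable_fun setT (fun x => (ln (r x))%:E).
  by apply/measurable_EFinP; exact: measurableT_comp.
have mexp : measurable_fun setT (fun x => (expR (- ln (r x)))%:E).
  apply/measurable_EFinP; apply: measurableT_comp => //.
  by apply: measurableT_comp => //; exact: measurableT_comp.
have negy : \int[rho]_x ((fun x => (ln (r x))%:E)^\- x) < +oo.
  apply: (@le_lt_trans _ _ (\int[rho]_x (1 * (expR (- ln (r x)))%:E))).
    apply: ge0_le_integral => //.
    - exact: measurable_funeneg.
    - by under eq_fun do rewrite mul1e.
    move=> x _; rewrite mul1e funenegE -EFinN -EFin_max lee_fin ge_max expR_ge0.
    rewrite andbT.
    by rewrite (le_trans _ (expR_ge1Dx _))// lerDr.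
  apply: le_lt_trans (KL_change_measure _ (measurable_cst 1)) _ => //.
  by rewrite integral_cst_probability ltry.
have posy : \int[rho]_x ((fun x => (ln (r x))%:E)^\+ x) < +oo.
  apply: has_expectation_funepos_lty KLy.
  rewrite /has_expectation adde_defN fin_num_adde_defl//.
  by rewrite ge0_fin_numE//; exact: integral_ge0.
exact: integrable_funeposneg.
Qed.

Lemma KL_density : exists l : T -> R, [/\ KL rho pi = \int[rho]_x (l x)%:E,
  KL rho pi < +oo -> rho.-integrable setT (EFin \o l) &
  forall h : T -> \bar R, (forall x, 0 <= h x) -> measurable_fun setT h ->
    \int[rho]_x (h x * (expR (- l x))%:E) <= \int[pi]_x h x].
Proof.
exists (fun x => ln (r x)); split; first exact: KL_lnE.
  exact: KL_lty_integrable.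
exact: KL_change_measure.
Qed.

End kullback_leibler.

Lemma expectationE d (T : measurableType d) (R : realType) (mu : probability T R)
  (X : T -> R) : 'E_mu[X] = \int[mu]_w (X w)%:E.
Proof. by rewrite unlock. Qed.

(** * Point masses compared with the uniform law *)

Section uniform.
Context d (T : measurableType d) (R : realType).

Lemma dirac_has_expectation (g : T) (f : T -> \bar R) : measurable_fun setT f ->
  has_expectation (\d_g : probability T R) f.
Proof.
move=> mf; rewrite /has_expectation !integral_dirac//.
- by rewrite diracT !mul1e; exact: add_def_funeposneg.
- exact: measurable_funeneg.
- exact: measurable_funepos.
Qed.

(** Singletons may fail to be measurable, so a property true at [g] has to come with a measurable
    set. *)
Lemma dirac_ae (g : T) (A : set T) : measurable A -> A g ->
  {ae (\d_g : probability T R), forall x, A x}.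
Proof.
move=> mA Ag; exists (~` A); split => //; first exact: measurableC.
have : \d_g (~` A) = 0 :> \bar R by rewrite diracE memNset// => /(_ Ag).
exact.
Qed.

(** The complement is the set where both Tonelli integrals equal [+oo]. This feeds [dirac_ae]. *)
Lemma measurable_has_expectation d' (S : measurableType d') (P : probability S R)
    (f : T * S -> \bar R) : measurable_fun setT f ->
  measurable [set x | has_expectation P (fun y => f (x, y))].
Proof.
move=> mf.
pose p x := \int[P]_y f^\+ (x, y); pose q x := \int[P]_y f^\- (x, y).
have mp : measurable_fun setT p.
  by apply: measurable_fun_integral; exact: measurable_funepos.
have mq : measurable_fun setT q.
  by apply: measurable_fun_integral; exact: measurable_funeneg.
rewrite (_ : [set x | _] = ~` (p @^-1` [set +oo] `&` q @^-1` [set +oo])).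
  apply: measurableC; apply: measurableI.
    by rewrite -[X in measurable X]setTI; exact: mp (emeasurable_set1 _).
  by rewrite -[X in measurable X]setTI; exact: mq (emeasurable_set1 _).
have p0 x : 0 <= p x by exact: integral_ge0.
have q0 x : 0 <= q x by exact: integral_ge0.
have hE x : has_expectation P (fun y => f (x, y)) = (p x +? - q x : Prop).
  rewrite /has_expectation (_ : \int[P]_y (fun y => f (x, y))^\+ y = p x);
    last first.
    by apply: eq_integral => y _; rewrite !funeposE.
  rewrite (_ : \int[P]_y (fun y => f (x, y))^\- y = q x)//.
  by apply: eq_integral => y _; rewrite !funenegE.
apply/seteqP; split => x /=; rewrite hE; first by move=> + [px qx]; rewrite px qx.
move=> npq; have := p0 x; have := q0 x; move: npq.
by case: (p x) => [a| |]; case: (q x) => [b| |] // [].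
Qed.

(** The level set of [f] through [g] replaces the possibly nonmeasurable singleton: it is measurable
    and contains at least one point, so its mass is at least the inverse of the cardinality. *)
Lemma ge0_uniform_integral (pi : probability T R) (f : T -> \bar R) (g : T) :
  finite_set [set: T] -> uniform_on_finite pi ->
  (forall x, 0 <= f x) -> measurable_fun setT f ->
  f g * (#|` fset_set [set: T]|%:R^-1)%:E <= \int[pi]_x f x.
Proof.
move=> finT pi_unif f0 mf; set N := #|` _|.
pose A := f @^-1` [set f g].
have mA : measurable A.
  by rewrite -[X in measurable X]setTI; exact: mf (emeasurable_set1 _).
have finA : finite_set A by apply: sub_finite_set finT.
have cardA : (0 < #|` fset_set A|)%N.
  by rewrite cardfs_gt0; apply/fset0Pn; exists g; rewrite in_fset_set// inE.
apply: (@le_trans _ _ (\int[pi]_(x in A) f x)); last exact: ge0_subset_integral.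
rewrite (eq_integral (cst (f g))); last by move=> x /set_mem.
have piA : (N%:R^-1)%:E <= pi A.
  by rewrite pi_unif// lee_fin -/N ler_peMl ?invr_ge0// ler1n.
by rewrite integral_cst//; exact: lee_wpmul2l.
Qed.

End uniform.

(** Bridges the count of points of the type, used by [uniform_on_finite], and the count of points of
    the set [G], used in the final bound. *)
Lemma card_fset_set_subset_type (T : choiceType) (G : set T) (G0 : G !=set0) :
  finite_set G ->
  finite_set [set: subset_type G0] /\
  #|` fset_set [set: subset_type G0]| = #|` fset_set G|.
Proof.
move=> finG; pose v : subset_type G0 -> T := fun x => sval x.
have v_inj : injective v by exact: val_inj.
have Gv : G = v @` setT.
  apply/seteqP; split => [x Gx|_ [y _ <-]]; last exact: set_mem (svalP y).
  by exists (exist _ x (mem_set Gx)).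
have finT : finite_set [set: subset_type G0].
  rewrite (_ : setT = v @^-1` G); last first.
    by apply/seteqP; split => // x _; exact: set_mem (svalP x).
  by apply: finite_preimage => // x y _ _; exact: v_inj.
have fG : fset_set G = [fset v x | x in fset_set [set: subset_type G0]]%fset.
  by rewrite -fset_set_image// -Gv.
by split => //; rewrite fG card_imfset.
Qed.

(** * The bound for a general prior and for a uniform one *)

Theorem theorem4p6 (R : realType)
  (dX dY : measure_display) (X : measurableType dX) (Y : measurableType dY)
  (SB : set (set {mfun X >-> Y})) (hSB : sigma_algebra setT SB)
  (G : set (g_sigma_algebraType SB)) (G0 : G !=set0)
  (SG : set (set (subset_type G0))) (hSG : sigma_algebra setT SG)
  (L : X * Y -> g_sigma_algebraType SB -> R)
  (mL : forall z, measurable_fun setT (L z))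
  (mLG : forall z, measurable_fun setT (fun g : g_sigma_algebraType SG => L z (model_incl g)))
  (delta : X * Y -> g_sigma_algebraType SG -> g_sigma_algebraType SB -> R)
  (mdelta : forall z, measurable_fun setT
    (fun p : g_sigma_algebraType SG * g_sigma_algebraType SB => delta z p.1 p.2))
  (lambda : R) (lambda_gt0 : (0 < lambda)%R)
  (pihat : probability (g_sigma_algebraType SG) R -> probability (g_sigma_algebraType SB) R)
  (variance_ineq : forall rho : probability (g_sigma_algebraType SG) R,
    online_variance_bound (@model_incl _ _ _ SG) lambda L delta rho (pihat rho))
  (pi : probability (g_sigma_algebraType SG) R)
  (n : nat) (z : nat -> X * Y)
  (dO : measure_display) (Omega : measurableType dO) (P : probability Omega R)
  (ghat : nat -> {RV P >-> g_sigma_algebraType SB})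
  (run : seqrand_run (@model_incl _ _ _ SG) lambda L delta pi pihat z ghat n)
  (loss_defined : has_expectation P (EFin \o total_loss L z ghat n)) :
  'E_P[total_loss L z ghat n] <=
    ereal_inf
      [set loss_bound (@model_incl _ _ _ SG) lambda L delta pi z ghat n rho
      | rho in [set rho : probability (g_sigma_algebraType SG) R |
          loss_bound_defined (@model_incl _ _ _ SG) lambda L delta pi z ghat n
            rho]]
  /\
  (finite_set G -> uniform_on_finite pi ->
    'E_P[total_loss L z ghat n] <=
      ereal_inf
        [set (fixed_loss (@model_incl _ _ _ SG) L z n g)%:E
             + 'E_P[total_delta delta z ghat n g]
             + (ln (#|` fset_set G|%:R) / lambda)%:E
        | g in [set g : g_sigma_algebraType SG |
            has_expectation P (EFin \o total_delta delta z ghat n g)]]).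
Proof.
have bound := @seqrand_bound R _ _ _ _ _ (@model_incl _ _ _ SG) lambda L delta
  lambda_gt0 mL mLG mdelta pi pihat variance_ineq z _ _ P ghat n run.
have mfixed := measurable_fixed_loss mLG z n.
have mtotal := measurable_total_delta mdelta z ghat n.
set s := fixed_loss _ L z n in bound mfixed *.
set D := total_delta delta z ghat n in bound mtotal *.
pose e g := \int[P]_w (D g w)%:E.
have eE g : 'E_P[D g] = e g by rewrite expectationE.
rewrite expectationE; split.
  apply: le_ereal_inf_tmp => _ [rho /= [hs hD he hse hsek] <-].
  have intE : \int[rho]_g 'E_P[D g] = \int[rho]_g e g.
    by apply: eq_integral => g _; rewrite eE.
  have eE' : (fun g => 'E_P[D g]) = e by apply/funext => g; rewrite eE.
  rewrite /loss_bound; move: hsek he hse.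
  rewrite -/s -/D expectationE intE eE' => hsek he hse.
  (* With an infinite divergence the bound is [+oo], because [hsek] keeps the other terms away from
     [-oo]. *)
  have [KLy|KLy] := eqVneq (KL rho pi) +oo.
    move: hsek; rewrite KLy gt0_muley ?lte_fin ?invr_gt0//.
    by case: (_ + \int[rho]_g e g) => [r| |] //= _; rewrite leey.
  have rho_pi : rho `<< pi.
    by apply: contra_neqP KLy => nrho; rewrite /KL asboolF.
  have [l [KLE il rho_le]] := KL_density rho_pi.
  have {}il : rho.-integrable setT (EFin \o l) by apply: il; rewrite ltey.
  pose k g := (lambda^-1 * l g)%R.
  have -> : lambda^-1%:E * KL rho pi = \int[rho]_g (k g)%:E.
    by rewrite KLE -(integralZl measurableT il).
  have ik : rho.-integrable setT (EFin \o k).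
    exact: (integrableZl measurableT lambda^-1 il).
  apply: (bound rho k ik _ loss_defined hs hD he hse).
  move=> f f0 mf; apply: le_trans (rho_le f f0 mf).
  rewrite le_eqVlt; apply/orP; left; apply/eqP; apply: eq_integral => g _.
  by rewrite mulVKf// gt_eqF.
move=> finG pi_unif; apply: le_ereal_inf_tmp => _ [g /= hD <-].
have [finT cardT] := card_fset_set_subset_type G0 finG.
set N := #|` fset_set G| in cardT *.
have me : measurable_fun setT e.
  apply: (measurable_fun_integral P (f := fun p => (D p.1 p.2)%:E)).
  exact/measurable_EFinP.
have ms : measurable_fun setT (EFin \o s) by exact/measurable_EFinP.
(* The comparison law is the point mass at [g], with the constant [ln N / lambda] as [k]. The weight
   [expR (- (lambda * k g))] is then [1 / N], and the condition on [rho] becomes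
   [ge0_uniform_integral]. *)
pose rho : probability (g_sigma_algebraType SG) R := \d_g.
have diracE f : measurable_fun setT f -> \int[rho]_x f x = f g.
  by move=> mf; rewrite integral_dirac// diracT mul1e.
have N0 : (0 < N)%N.
  rewrite -cardT cardfs_gt0; apply/fset0Pn; exists g.
  by rewrite in_fset_set// inE.
have := bound rho (cst (lambda^-1 * ln N%:R)%R).
rewrite integral_cst_probability !diracE// => bound_g.
rewrite eE (_ : (ln N%:R / lambda = lambda^-1 * ln N%:R)%R); last by rewrite mulrC.
apply: bound_g => //.
- exact: finite_measure_integrable_cst.
- move=> f f0 mf; rewrite diracE/=; last first.
    by apply: emeasurable_funM => //.
  rewrite mulVKf ?gt_eqF// expRN lnK ?posrE ?ltr0n// -cardT.
  exact: ge0_uniform_integral.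
- exact: dirac_has_expectation.
- apply: (@dirac_ae _ _ R g [set x | has_expectation P (EFin \o D x)] _ hD).
  apply: (measurable_has_expectation P (f := fun p => (D p.1 p.2)%:E)).
  exact/measurable_EFinP.
- exact: dirac_has_expectation.
Qed.
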